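(* Let $m$ be a string transduction. Then $m\in\mathcal{MSO}_{\mathrm{ed}}$ if and only if $m\in\bigcup_{k\ge1}\mathcal{NGSM}^k$ and $m$ is functional.
   Context: A 2gsm is $M=(Q,\Sigma_1,\Sigma_2,\delta,q_{in},q_f)$ with finite state set $Q$ and instructions $(p,\sigma,q_1,\alpha_1,\epsilon_1,q_0,\alpha_0,\epsilon_0)$, $p\neq q_f$, $\sigma\in\Sigma_1\cup\{\vdash,\dashv\}$, $\alpha_i\in\Sigma_2^*$, $\epsilon_i\in\{-1,0,+1\}$. On input $w$ the read-only tape is $\vdash w\dashv$ (positions $0..|w|+1$); start in $q_{in}$ at position 0; in state $p$ any instruction starting with $p$ may be executed: if the scanned symbol is $\sigma$, go to $q_1$, append $\alpha_1$ to the one-way output tape and move by $\epsilon_1$, else do the same with $(q_0,\alpha_0,\epsilon_0)$; the head may not leave the tape. $M$ realizes the relation of all $(w,z)$ such that some computation reaches $q_f$ having written $z$. $\mathcal{NGSM}$ is the family of transductions realized by 2gsm's, and $\mathcal{NGSM}^k$ the family of compositions of $k$ of them (composition $R_1\circ R_2=\{(a,c)\mid\exists b:(a,b)\in R_1,(b,c)\in R_2\}$). A relation $m$ is functional if $(w,z_1),(w,z_2)\in m$ imply $z_1=z_2$. Graphs are $(V,E,\mathrm{lab})$ with $E\subseteq V\times\Gamma\times V$, $\mathrm{lab}:V\to\Sigma$; monadic second-order logic on graphs has node and node-set variables and atomic formulas $\mathrm{lab}_\sigma(x)$, $\mathrm{edge}_\gamma(x,y)$, $x=y$, $x\in X$.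 An mso definable graph transduction is a partial function given by a closed domain formula $\varphi_{\mathrm{dom}}$, a finite copy set $C$, node formulas $\varphi^c_\sigma(x)$ and edge formulas $\varphi^{c_1,c_2}_\gamma(x,y)$; on input $g\models\varphi_{\mathrm{dom}}$ the output has nodes $(u,c)$ for which exactly one $\sigma$ satisfies $g\models\varphi^c_\sigma(u)$ (labelled $\sigma$) and edges $((u,c_1),\gamma,(v,c_2))$ between such nodes iff $g\models\varphi^{c_1,c_2}_\gamma(u,v)$. For $w$ of length $k$, $\mathrm{ed}(w)$ has $k+1$ unlabelled nodes forming a path whose edges are labelled by the letters of $w$; $\mathcal{MSO}_{\mathrm{ed}}$ is the family of string transductions $m$ such that $\{(\mathrm{ed}(w),\mathrm{ed}(z))\mid(w,z)\in m\}$ is an mso definable graph transduction. *)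

(* Defs.v *)
From Stdlib Require List Relations.
From mathcomp Require Import all_boot.

Set Implicit Arguments.
Unset Strict Implicit.
Unset Printing Implicit Defensive.

Definition transduction (A B : Type) := seq A -> seq B -> Prop.

Definition functional (A B : Type) (m : transduction A B) : Prop :=
  forall w z1 z2, m w z1 -> m w z2 -> z1 = z2.

Definition tcomp (A B C : Type) (m1 : transduction A B) (m2 : transduction B C)
  : transduction A C := fun a c => exists b, m1 a b /\ m2 b c.

Inductive tsym (A : Type) := LEnd | REnd | Sym of A.
Arguments LEnd {A}.
Arguments REnd {A}.

Inductive dir := MLeft | MStay | MRight.

(* symbol at position i of the tape |- w -| (positions 0 .. |w|+1) *)
Definition tape (A : Type) (w : seq A) (i : nat) : tsym A :=
  if i is j.+1 then (if onth w j is Some a then Sym a else REnd) else LEnd.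

Definition move (A : Type) (w : seq A) (d : dir) (i : nat) : option nat :=
  match d with
  | MLeft => if i is j.+1 then Some j else None
  | MStay => Some i
  | MRight => if i < (size w).+1 then Some i.+1 else None
  end.

Record instr (Q A B : Type) := Instr {
  i_p : Q; i_sym : tsym A;
  i_q1 : Q; i_out1 : seq B; i_d1 : dir;
  i_q0 : Q; i_out0 : seq B; i_d0 : dir }.

Record gsm2 (A B : Type) := Gsm2 {
  gQ : finType;
  g_qin : gQ;
  g_qf : gQ;
  g_delta : seq (instr gQ A B);
  g_delta_ok : all (fun ins => i_p ins != g_qf) g_delta }.

(* configurations: (state, head position, output written so far) *)
Definition config (A B : Type) (M : gsm2 A B) := (gQ M * nat * seq B)%type.

Definition gstep (A B : Type) (M : gsm2 A B) (w : seq A) (c c' : config M) : Prop :=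
  let: (p, i, out) := c in
  exists ins, List.In ins (g_delta M) /\ i_p ins = p /\
   ((tape w i = i_sym ins /\
       exists j, move w (i_d1 ins) i = Some j /\ c' = (i_q1 ins, j, out ++ i_out1 ins))
    \/
    (tape w i <> i_sym ins /\
       exists j, move w (i_d0 ins) i = Some j /\ c' = (i_q0 ins, j, out ++ i_out0 ins))).

Definition realized (A B : Type) (M : gsm2 A B) : transduction A B :=
  fun w z => exists j,
    Relation_Operators.clos_refl_trans (config M) (@gstep A B M w) (g_qin M, 0, [::]) (g_qf M, j, z).

Definition inNGSM (A B : finType) (m : transduction A B) : Prop :=
  exists M : gsm2 A B, forall w z, m w z <-> realized M w z.

Fixpoint NGSMk (k : nat) (A B : finType) (m : transduction A B) : Prop :=
  match k with
  | 0 => False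
  | k'.+1 =>
    if k' is 0 then inNGSM m
    else exists (C : finType) (m1 : transduction A C) (m2 : transduction C B),
        NGSMk k' m1 /\ inNGSM m2 /\ forall w z, m w z <-> tcomp m1 m2 w z
  end.

Record graph (S G : Type) := Graph {
  gV : finType;
  gE : gV -> G -> gV -> Prop;
  glab : gV -> S }.
Arguments gV {S G}.
Arguments gE {S G}.
Arguments glab {S G}.

Definition giso (S G : Type) (g h : graph S G) : Prop :=
  exists f : gV g -> gV h, bijective f /\
    (forall v, @glab S G h (f v) = @glab S G g v) /\
    (forall u a v, @gE S G g u a v <-> @gE S G h (f u) a (f v)).

(* ed(w): k+1 unlabelled nodes forming a path whose edges are labelled by
   the letters of w (edge i -> i+1 labelled w_i, 0-indexed) *)
Definition ed (A : Type) (w : seq A) : graph unit A :=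
  @Graph unit A 'I_(size w).+1
    (fun i a j => (j : nat) = (i : nat).+1 /\ onth w i = Some a)
    (fun _ => tt).

(* MSO formulas; node variables and node-set variables are named by nat *)
Inductive mso (S G : Type) :=
| FLab of S & nat
| FEdge of G & nat & nat
| FEq of nat & nat
| FIn of nat & nat
| FNeg of mso S G
| FAnd of mso S G & mso S G
| FOr of mso S G & mso S G
| FExN of nat & mso S G
| FExS of nat & mso S G.

Fixpoint fv_node (S G : Type) (f : mso S G) : seq nat :=
  match f with
  | FLab _ x => [:: x]
  | FEdge _ x y => [:: x; y]
  | FEq x y => [:: x; y]
  | FIn x _ => [:: x]
  | FNeg f1 => fv_node f1
  | FAnd f1 f2 => fv_node f1 ++ fv_node f2
  | FOr f1 f2 => fv_node f1 ++ fv_node f2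
  | FExN x f1 => [seq y <- fv_node f1 | y != x]
  | FExS _ f1 => fv_node f1
  end.

Fixpoint fv_set (S G : Type) (f : mso S G) : seq nat :=
  match f with
  | FLab _ _ | FEdge _ _ _ | FEq _ _ => [::]
  | FIn _ X => [:: X]
  | FNeg f1 => fv_set f1
  | FAnd f1 f2 => fv_set f1 ++ fv_set f2
  | FOr f1 f2 => fv_set f1 ++ fv_set f2
  | FExN _ f1 => fv_set f1
  | FExS X f1 => [seq Y <- fv_set f1 | Y != X]
  end.

Definition upd (T : Type) (nu : nat -> T) (x : nat) (a : T) : nat -> T :=
  fun y => if y == x then a else nu y.

Fixpoint sat (S G : Type) (g : graph S G) (nu : nat -> option (gV g))
    (mu : nat -> gV g -> Prop) (f : mso S G) : Prop :=
  match f with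
  | FLab s x => exists v, nu x = Some v /\ glab g v = s
  | FEdge a x y => exists u v, nu x = Some u /\ nu y = Some v /\ gE g u a v
  | FEq x y => exists v, nu x = Some v /\ nu y = Some v
  | FIn x X => exists v, nu x = Some v /\ mu X v
  | FNeg f1 => ~ sat nu mu f1
  | FAnd f1 f2 => sat nu mu f1 /\ sat nu mu f2
  | FOr f1 f2 => sat nu mu f1 \/ sat nu mu f2
  | FExN x f1 => exists v : gV g, sat (upd nu x (Some v)) mu f1
  | FExS X f1 => exists P : gV g -> Prop, sat nu (upd mu X P) f1
  end.

Definition nu0 (V : Type) : nat -> option V := fun _ => None.
Definition mu0 (V : Type) : nat -> V -> Prop := fun _ _ => False.
(* the free node variable x of a node formula is variable 0 *)
Definition nu1 (V : Type) (u : V) : nat -> option V := upd (@nu0 V) 0 (Some u).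
(* the free node variables x, y of an edge formula are variables 0, 1 *)
Definition nu2 (V : Type) (u v : V) : nat -> option V := upd (nu1 u) 1 (Some v).

Record msot (S G S' G' : Type) := Msot {
  t_C : finType;
  t_dom : mso S G;
  t_node : t_C -> S' -> mso S G;
  t_edge : t_C -> t_C -> G' -> mso S G }.
Arguments t_C {S G S' G'}.
Arguments t_dom {S G S' G'}.
Arguments t_node {S G S' G'}.
Arguments t_edge {S G S' G'}.

Definition msot_wf (S G S' G' : Type) (T : msot S G S' G') : Prop :=
  fv_node (t_dom T) = [::] /\ fv_set (t_dom T) = [::] /\
  (forall c s, all (fun x => x == 0) (fv_node (t_node T c s)) /\
               fv_set (t_node T c s) = [::]) /\
  (forall c1 c2 a, all (fun x => (x == 0) || (x == 1)) (fv_node (t_edge T c1 c2 a)) /\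
                   fv_set (t_edge T c1 c2 a) = [::]).

Definition out_node (S G S' G' : Type) (T : msot S G S' G') (g : graph S G)
    (u : gV g) (c : t_C T) : Prop :=
  exists! s : S', sat (nu1 u) (@mu0 _) (t_node T c s).

Arguments out_node {S G S' G'} T g u c.

(* h is (isomorphic to) the output graph of T on input g *)
Definition is_output (S G S' G' : Type) (T : msot S G S' G') (g : graph S G)
    (h : graph S' G') : Prop :=
  exists f : gV h -> (gV g * t_C T)%type,
    injective f /\
    (forall p : (gV g * t_C T)%type, out_node T g p.1 p.2 <-> exists v, f v = p) /\
    (forall v, sat (nu1 (f v).1) (@mu0 _) (t_node T (f v).2 (glab h v))) /\
    (forall v1 a v2, gE h v1 a v2 <->
        sat (nu2 (f v1).1 (f v2).1) (@mu0 _) (t_edge T (f v1).2 (f v2).2 a)).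

Arguments is_output {S G S' G'} T g h.

Definition msot_rel (S G S' G' : Type) (T : msot S G S' G') (g : graph S G)
    (h : graph S' G') : Prop :=
  @sat S G g (@nu0 _) (@mu0 _) (t_dom T) /\ is_output T g h.

Arguments msot_rel {S G S' G'} T g h.

(* MSO_ed: {(ed w, ed z) | (w,z) in m} is an mso definable graph
   transduction (graphs being considered up to isomorphism) *)
Definition MSOed (A B : finType) (m : transduction A B) : Prop :=
  exists T : msot unit A unit B, msot_wf T /\
    forall (g : graph unit A) (h : graph unit B),
      (exists w z, m w z /\ giso g (ed w) /\ giso h (ed z)) <-> msot_rel T g h.

(* Main.v *)
(* An MSO formula on the path graph [ed w] is evaluated by a finite "multiplication" on the word
   [w] with its free variables marked. Hence, once each node is annotated with the values of the
   prefix and suffix around it (a first 2gsm), a second 2gsm can go from an output node to the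
   next one by guessing the direction and the target, and checking the edge formula on arrival.

   Conversely, let [m] be a functional composition of 2gsm's. From right to left, every factor,
   with its output restricted to the regular domain of the factors already treated, is replaced by
   a functional MSO definable part of it with the same domain; the composition of these parts is
   again MSO definable, is contained in [m] and has the same domain, so it is [m]. To find such a
   part for one 2gsm, consider strategies that choose one instruction in each configuration.
   That a strategy leads from the initial to a final configuration is MSO definable, as is the
   lexicographically least such strategy; its path, read as a string of instructions, is an MSO
   definable function of the input, to which the output homomorphism is applied. *)

Require Import Defs.
From Stdlib Require Import Relation_Operators Operators_Properties.
From mathcomp Require Import all_boot boolp.

Set Implicit Arguments.
Unset Strict Implicit.
Unset Printing Implicit Defensive.

(** * Definability in MSO *)

(** The computations of a machine on a word may be infinitely many and arbitrarily long, so no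
    formula can range over them. Strategies avoid this because they need no memory: a vertex is a
    position, a state and the value, in a finite multiplication, of the output written so far, and a
    shortest walk to a final vertex repeats no vertex. A strategy is thus a family of node sets
    indexed by a fixed finite type, over which monadic quantifiers can range.

    Carrying the value in the vertex turns a regular restriction on the output into a condition on
    the final vertex. This is what forces the order from right to left: a selection made for a left
    factor without regard to the factors on its right could produce a word on which they are
    undefined, and so lose part of the domain.

    Definability is treated semantically, over families of path graphs rather than over words,
    because the closure under composition needs families indexed by pairs of words. In the other
    direction, outside the domain of the transduction its formulas are unconstrained; the domain
    must therefore be tested where the walk through the output begins. *)

Section Satisfaction.
Variables S G : Type.

Lemma upd_eq (T : Type) (nu : nat -> T) x a : upd nu x a x = a.
Proof. by rewrite /upd eqxx. Qed.

Lemma upd_neq (T : Type) (nu : nat -> T) x a y : y != x -> upd nu x a y = nu y.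
Proof. by rewrite /upd => /negbTE->. Qed.

Lemma sat_iso (g h : graph S G) (F : gV g -> gV h) (F' : gV h -> gV g) (f : mso S G) nu mu :
  cancel F F' -> cancel F' F ->
  (forall v, glab h (F v) = glab g v) ->
  (forall u a v, gE g u a v <-> gE h (F u) a (F v)) ->
  sat nu mu f <-> sat (fun x => omap F (nu x)) (fun X v => mu X (F' v)) f.
Proof.
move=> FK F'K Hlab HE.
have Ho (o : option (gV g)) v : omap F o = Some v <-> o = Some (F' v).
  split=> [|->]; last by rewrite /= F'K.
  by case: o => //= u [<-]; rewrite FK.
elim: f nu mu => [s x|a x y|x y|x X|f IH|f1 IH1 f2 IH2|f1 IH1 f2 IH2|x f IH|X f IH] nu mu /=.
- split=> -[v [H1 H2]]; first by exists (F v); rewrite H1 Hlab.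
  by move/Ho: H1 => H1; exists (F' v); rewrite -Hlab F'K.
- split=> -[u [v [H1 [H2 H3]]]]; first by exists (F u), (F v); rewrite H1 H2 -HE.
  by exists (F' u), (F' v); rewrite HE !F'K; split; [apply/Ho|split; [apply/Ho|]].
- split=> -[v [H1 H2]]; first by exists (F v); rewrite H1 H2.
  by exists (F' v); split; apply/Ho.
- split=> -[v [H1 H2]]; first by exists (F v); rewrite H1 FK.
  by exists (F' v); split=> //; apply/Ho.
- by rewrite IH.
- by rewrite IH1 IH2.
- by rewrite IH1 IH2.
- split=> -[v Hv].
  + exists (F v); move/IH: Hv; congr (sat _ _ _); apply: funext => y.
    by rewrite /upd; case: eqP.
  + exists (F' v); apply/IH; move: Hv; congr (sat _ _ _); apply: funext => y.
    by rewrite /upd; case: eqP => //=; rewrite F'K.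
- split=> -[P HP].
  + exists (fun v => P (F' v)); move/IH: HP; congr (sat _ _ _); apply: funext => Y.
    by rewrite /upd; case: eqP.
  + exists (fun v => P (F v)); apply/IH; move: HP; congr (sat _ _ _); apply: funext => Y.
    rewrite /upd; case: eqP => // _; apply: funext => v; by rewrite F'K.
Qed.

Lemma sat_exs (g : graph S G) nu (mu : nat -> gV g -> Prop) f l :
  sat nu mu (foldr (@FExS S G) f l) <->
  exists mu', (forall X, X \notin l -> mu' X = mu X) /\ sat nu mu' f.
Proof.
elim: l mu => [|X l IH] mu /=.
  split=> [H|[mu' [H]]]; first by exists mu.
  by rewrite (_ : mu' = mu) //; apply: funext => X; apply: H.
split=> [[P /IH[mu' [H1 H2]]]|[mu' [H1 H2]]].
- exists mu'; split=> // Y; rewrite inE negb_or => /andP[YX Yl].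
  by rewrite H1 // upd_neq.
- exists (mu' X); apply/IH; exists mu'; split=> // Y Yl.
  by rewrite /upd; case: eqP => [->//|/eqP YX]; apply: H1; rewrite inE negb_or YX.
Qed.

Lemma fv_node_exs (f : mso S G) l : fv_node (foldr (@FExS S G) f l) = fv_node f.
Proof. by elim: l. Qed.

Lemma fv_set_exs (f : mso S G) l :
  fv_set (foldr (@FExS S G) f l) = [seq X <- fv_set f | X \notin l].
Proof.
elim: l => [|X l IH] /=; first by rewrite filter_predT.
by rewrite IH -filter_predI; apply: eq_filter => Y /=; rewrite inE negb_or.
Qed.

End Satisfaction.

Section Definability.
Variables (A K : Type) (Gr : K -> graph unit A).
Local Notation pos k := (gV (Gr k)).

(* A context is a family of environments stored in the node variables below [nn]
   and the set variables below [ns]. *)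
Record ctx := Ctx {
  env : K -> Type;
  nn : nat;
  ns : nat;
  enu : forall k, env k -> nat -> option (pos k);
  emu : forall k, env k -> nat -> pos k -> Prop }.

(** Definability as a semantic property: a single formula for all indices [k], with free variables
    inside the context. Closure lemmas then take the place of writing formulas and managing variable
    names. *)
Definition Def (c : ctx) (P : forall k, env c k -> Prop) :=
  exists f : mso unit A, all (fun x => x < nn c) (fv_node f) /\
    all (fun X => X < ns c) (fv_set f) /\
    forall k (e : env c k), sat (enu e) (emu e) f <-> P k e.

Definition Acc (c : ctx) (t : forall k, env c k -> pos k) :=
  exists x, x < nn c /\ forall k (e : env c k), enu e x = Some (t k e).

Definition SAcc (c : ctx) (t : forall k, env c k -> pos k -> Prop) :=
  exists X, X < ns c /\ forall k (e : env c k), emu e X = t k e.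

Definition c0 : ctx :=
  @Ctx (fun _ => unit) 0 0 (fun k _ => @nu0 _) (fun k _ => @mu0 _).

Definition extN (c : ctx) : ctx :=
  @Ctx (fun k => (env c k * pos k)%type) (nn c).+1 (ns c)
    (fun k e => upd (enu e.1) (nn c) (Some e.2)) (fun k e => emu e.1).

(** The family takes [#|J|] consecutive set variables from [ns c] on, with offset [enum_rank j] for
    [j]. Variables outside this block keep their values, which is the form in which [sat_exs]
    describes a block of quantifiers. *)
Definition extF (c : ctx) (J : finType) : ctx :=
  @Ctx (fun k => (env c k * (J -> pos k -> Prop))%type) (nn c) (ns c + #|J|)
    (fun k e => enu e.1)
    (fun k e X => if X < ns c then emu e.1 X else
       if (insub (X - ns c) : option 'I_#|J|) is Some i then e.2 (enum_val i) else emu e.1 X).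

Lemma Def_ext c P Q : (forall k e, P k e <-> Q k e) -> @Def c P -> @Def c Q.
Proof. by move=> H [f [? [? Hf]]]; exists f; do 2!split=> //; move=> k e; rewrite Hf H. Qed.

Lemma Def_not c P : @Def c P -> @Def c (fun k e => ~ P k e).
Proof. by move=> [f [? [? Hf]]]; exists (FNeg f); do 2!split=> //; move=> k e /=; rewrite Hf. Qed.

Lemma Def_and c P Q : @Def c P -> @Def c Q -> @Def c (fun k e => P k e /\ Q k e).
Proof.
move=> [f [Hf1 [Hf2 Hf]]] [f' [Hf1' [Hf2' Hf']]]; exists (FAnd f f') => /=.
by rewrite !all_cat Hf1 Hf2 Hf1'; do 2!split=> //; move=> *; rewrite Hf Hf'.
Qed.

Lemma Def_or c P Q : @Def c P -> @Def c Q -> @Def c (fun k e => P k e \/ Q k e).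
Proof.
move=> [f [Hf1 [Hf2 Hf]]] [f' [Hf1' [Hf2' Hf']]]; exists (FOr f f') => /=.
by rewrite !all_cat Hf1 Hf2 Hf1'; do 2!split=> //; move=> *; rewrite Hf Hf'.
Qed.

Lemma Def_imp c P Q : @Def c P -> @Def c Q -> @Def c (fun k e => P k e -> Q k e).
Proof.
move=> HP HQ; apply: Def_ext (Def_or (Def_not HP) HQ) => k e.
by split=> [[]//|H]; case: (EM (P k e)); [right; apply: H|left].
Qed.

Lemma Def_iff c P Q : @Def c P -> @Def c Q -> @Def c (fun k e => P k e <-> Q k e).
Proof. by move=> HP HQ; apply: Def_and; apply: Def_imp. Qed.

Lemma Def_const c (P : Prop) : @Def c (fun _ _ => P).
Proof.
have H1 : @Def c (fun k e => False).
  (* Falsity as a closed formula: some node differs from itself. Together with its negation it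
     covers both truth values of [P]. *)
  exists (FExN 0 (FNeg (FEq unit A 0 0))); do 2!split=> //.
  by move=> k e; split=> // -[v] /=; rewrite upd_eq => -[]; exists v.
case: (EM P) => HP; last by apply: Def_ext H1.
by apply: Def_ext (Def_not H1) => k e; split=> // _ [].
Qed.

Lemma Def_exN c (P : forall k, env c k -> pos k -> Prop) :
  @Def (extN c) (fun k e => P k e.1 e.2) -> @Def c (fun k e => exists v, P k e v).
Proof.
move=> [f [H1 [H2 Hf]]]; exists (FExN (nn c) f); split.
  rewrite /= all_filter; apply: sub_all H1 => x /=; rewrite ltnS leq_eqVlt.
  by case: eqP.
split=> //= k e; by split=> -[v Hv]; exists v; apply/(Hf k (e, v)).
Qed.

Lemma Def_allN c (P : forall k, env c k -> pos k -> Prop) :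
  @Def (extN c) (fun k e => P k e.1 e.2) -> @Def c (fun k e => forall v, P k e v).
Proof.
move=> H; apply: Def_ext (Def_not (Def_exN (P := fun k e v => ~ P k e v) (Def_not H))) => k e /=.
split=> [H1 v|H1 [v]]; last by apply; apply: H1.
by apply: contrapT => H2; apply: H1; exists v.
Qed.

Lemma Def_exF c (J : finType) (P : forall k, env c k -> (J -> pos k -> Prop) -> Prop) :
  @Def (extF c J) (fun k e => P k e.1 e.2) -> @Def c (fun k e => exists Z, P k e Z).
Proof.
move=> [f [H1 [H2 Hf]]]; exists (foldr (@FExS _ _) f (iota (ns c) #|J|)).
rewrite fv_node_exs fv_set_exs; split=> //; split.
  rewrite all_filter; apply: sub_all H2 => X /=; rewrite mem_iota => ->.
  by rewrite andbT ltnNge; case: leq.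
move=> k e; rewrite sat_exs; split=> [[mu' [Hm Hs]]|[Z HZ]]; last first.
- exists (emu ((e, Z) : env (extF c J) k)); split; last by apply/(Hf k (e, Z)).
  move=> X /=; rewrite mem_iota negb_and -ltnNge -leqNgt.
  case: ltnP => //= HX1; case: insubP => // i Hi _.
  by rewrite -leq_subRL // leqNgt Hi.
- exists (fun j => mu' (ns c + enum_rank j)); apply/(Hf k (e, _)).
  move: Hs; congr (sat _ _ _); apply: funext => X /=.
  case: ltnP => HX; first by rewrite Hm // mem_iota; move: (HX); rewrite ltnNge => /negbTE->.
  case: insubP => [i _ Hi|Hi]; first by rewrite enum_valK Hi subnKC.
  by apply: Hm; rewrite mem_iota HX /= -leqNgt -leq_subRL // leqNgt.
Qed.

Lemma Def_allF c (J : finType) (P : forall k, env c k -> (J -> pos k -> Prop) -> Prop) :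
  @Def (extF c J) (fun k e => P k e.1 e.2) -> @Def c (fun k e => forall Z, P k e Z).
Proof.
move=> H; apply: Def_ext (Def_not (Def_exF (P := fun k e Z => ~ P k e Z) (Def_not H))) => k e /=.
split=> [H1 v|H1 [v]]; last by apply; apply: H1.
by apply: contrapT => H2; apply: H1; exists v.
Qed.

Lemma Def_exfin c (J : finType) (P : J -> forall k, env c k -> Prop) :
  (forall j, @Def c (P j)) -> @Def c (fun k e => exists j, P j k e).
Proof.
move=> H; suff HS (s : seq J) : @Def c (fun k e => exists2 j, j \in s & P j k e).
  apply: Def_ext (HS (enum J)) => k e; split=> [[j]|[j]]; first by exists j.
  by exists j => //; rewrite mem_enum.
elim: s => [|j s IH].
  by apply: (Def_ext _ (Def_const c False)) => k e; split=> // -[].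
apply: Def_ext (Def_or (H j) IH) => k e; split=> [[|[i Hi]]|[i]].
- by exists j => //; apply: mem_head.
- by exists i => //; rewrite inE orbC Hi.
- by rewrite inE => /orP[/eqP->|]; [left|right; exists i].
Qed.

Lemma Def_allfin c (J : finType) (P : J -> forall k, env c k -> Prop) :
  (forall j, @Def c (P j)) -> @Def c (fun k e => forall j, P j k e).
Proof.
move=> H; apply: Def_ext (Def_not (Def_exfin (fun j => Def_not (H j)))) => k e /=.
split=> [H1 v|H1 [v]]; last by apply; apply: H1.
by apply: contrapT => H2; apply: H1; exists v.
Qed.

Lemma Def_edge c t t' a : @Acc c t -> @Acc c t' ->
  @Def c (fun k e => gE (Gr k) (t k e) a (t' k e)).
Proof.
move=> [x [Hx Ht]] [y [Hy Ht']]; exists (FEdge _ a x y); rewrite /= Hx Hy; do 2!split=> //.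
move=> k e; rewrite Ht Ht'; split=> [[u [v [[->] [[->]]]]]//|H].
by exists (t k e), (t' k e).
Qed.

Lemma Def_eq c t t' : @Acc c t -> @Acc c t' -> @Def c (fun k e => t k e = t' k e).
Proof.
move=> [x [Hx Ht]] [y [Hy Ht']]; exists (FEq _ _ x y); rewrite /= Hx Hy; do 2!split=> //.
move=> k e; rewrite Ht Ht'; split=> [[u [[->] [->]]]//|->].
by exists (t' k e).
Qed.

Lemma Def_in c t Z : @Acc c t -> @SAcc c Z -> @Def c (fun k e => Z k e (t k e)).
Proof.
move=> [x [Hx Ht]] [X [HX HZ]]; exists (FIn _ _ x X); rewrite /= Hx HX; do 2!split=> //.
move=> k e; rewrite Ht HZ; split=> [[u [[->] ?]]//|H].
by exists (t k e).
Qed.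

Lemma Acc_last c : @Acc (extN c) (fun k e => e.2).
Proof. by exists (nn c); split=> // k e /=; rewrite upd_eq. Qed.

Lemma Acc_extN c t : @Acc c t -> @Acc (extN c) (fun k e => t k e.1).
Proof.
move=> [x [Hx Ht]]; exists x; split; first by rewrite /= ltnS ltnW.
by move=> k e /=; rewrite upd_neq ?neq_ltn ?Hx.
Qed.

Lemma Acc_extF c J t : @Acc c t -> @Acc (extF c J) (fun k e => t k e.1).
Proof. by move=> [x [Hx Ht]]; exists x; split=> // k e; apply: Ht. Qed.

Lemma SAcc_extN c Z : @SAcc c Z -> @SAcc (extN c) (fun k e => Z k e.1).
Proof. by move=> [x [Hx Ht]]; exists x; split=> // k e; apply: Ht. Qed.

Lemma SAcc_extF c J Z : @SAcc c Z -> @SAcc (extF c J) (fun k e => Z k e.1).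
Proof.
move=> [X [HX Ht]]; exists X; split; first by rewrite /= ltn_addr.
by move=> k e /=; rewrite HX.
Qed.

Lemma SAcc_last c (J : finType) (j : J) : @SAcc (extF c J) (fun k e => e.2 j).
Proof.
exists (ns c + enum_rank j); split; first by rewrite ltn_add2l.
move=> k e /=; rewrite ltnNge leq_addr /= addKn; case: insubP => [i _ Hi|]; last by rewrite ltn_ord.
by rewrite (_ : i = enum_rank j) ?enum_rankK //; apply: val_inj.
Qed.

End Definability.

(** * Backward translation *)

(* A node of [Hr k] is coded by a node of [Gr k] and a copy in [C], so that a set of nodes of
   [Hr k] is coded by [C] sets of nodes of [Gr k]. *)
Section Backward.
Variables (A B K : Type) (Gr : K -> graph unit A) (Hr : K -> graph unit B) (C : finType).
Variable F : forall k, gV (Hr k) -> gV (Gr k) * C.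
Hypothesis F_inj : forall k, injective (@F k).
Hypothesis Hnode : forall (c : ctx Gr) t j, Acc t ->
  @Def _ _ _ c (fun k e => exists v, F v = (t k e, j)).
Hypothesis Hedge : forall (c : ctx Gr) t t' j j' a, Acc t -> Acc t' ->
  @Def _ _ _ c (fun k e => exists v v', F v = (t k e, j) /\ F v' = (t' k e, j') /\ gE (Hr k) v a v').

Let pre k (p : gV (Gr k) * C) : option (gV (Hr k)) := [pick v | F v == p].

Let preP (k : K) p (v : gV (Hr k)) : pre p = Some v <-> F v = p.
Proof.
rewrite /pre; case: pickP => [u /eqP Hu|H]; last by split=> // Hv; move: (H v); rewrite Hv eqxx.
by split=> [[<-]//|Hv]; congr Some; apply: (@F_inj k); rewrite Hv.
Qed.

(** Induction on the formula, with a fixed copy [j] attached to every free node variable. A node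
    quantifier becomes a finite disjunction over copies of node quantifiers, a set quantifier
    becomes a block of [C] set quantifiers. A pair outside the range of [F] yields no value, and
    atoms are false on variables without value. *)
Lemma Def_backward (f : mso unit B) (c : ctx Gr)
  (nu : forall k, env c k -> nat -> option (gV (Hr k)))
  (mu : forall k, env c k -> nat -> gV (Hr k) -> Prop) :
  {in fv_node f, forall x, exists j t, Acc t /\ forall k e, nu k e x = pre (t k e, j)} ->
  {in fv_set f, forall X, forall j, exists Z, SAcc Z /\
     forall k e v, (F v).2 = j -> (mu k e X v <-> Z k e (F v).1)} ->
  @Def _ _ _ c (fun k e => sat (nu k e) (mu k e) f).
Proof.
elim: f c nu mu => [s x|a x y|x y|x X|f IH|f1 IH1 f2 IH2|f1 IH1 f2 IH2|x f IH|X f IH] c nu mu /= Hn Hs.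
- have [j [t [Ht Hx]]] := Hn x (mem_head _ _).
  apply: Def_ext (Hnode j Ht) => k e; rewrite Hx.
  by split=> -[v Hv]; exists v; [split; [apply/preP|case: s (glab _ _) => -[]]|case: Hv => /preP].
- have [j [t [Ht Hx]]] := Hn x (mem_head _ _).
  have [j' [t' [Ht' Hy]]] := Hn y (mem_last _ [:: y]).
  apply: Def_ext (Hedge j j' a Ht Ht') => k e; rewrite Hx Hy.
  by split=> -[u [v [/preP ? [/preP ? ?]]]]; exists u, v.
- have [j [t [Ht Hx]]] := Hn x (mem_head _ _).
  have [j' [t' [Ht' Hy]]] := Hn y (mem_last _ [:: y]).
  apply: Def_ext (Def_and (Def_const c (j = j')) (Def_and (Def_eq Ht Ht') (Hnode j Ht))) => k e.
  rewrite Hx Hy; split=> [[<- [<- [v Hv]]]|[v [/preP H1 /preP H2]]].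
    by exists v; split; apply/preP.
  by move: (H2); rewrite H1 => -[<- <-]; do 2!split=> //; exists v.
- have [j [t [Ht Hx]]] := Hn x (mem_head _ _).
  have [Z [HZ HX]] := Hs X (mem_head _ _) j.
  apply: Def_ext (Def_and (Hnode j Ht) (Def_in Ht HZ)) => k e; rewrite Hx.
  split=> [[[v Hv] H]|[v [/preP Hv H]]].
    by exists v; split; [apply/preP|apply/(HX k e v); rewrite Hv].
  by split; [exists v|move/(HX k e v): H; rewrite Hv; apply].
- by apply: Def_not; apply: IH.
- apply: Def_and; [apply: IH1|apply: IH2] => x Hx.
  + by apply: Hn; rewrite mem_cat Hx.
  + by apply: Hs; rewrite mem_cat Hx.
  + by apply: Hn; rewrite mem_cat Hx orbT.
  + by apply: Hs; rewrite mem_cat Hx orbT.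
- apply: Def_or; [apply: IH1|apply: IH2] => x Hx.
  + by apply: Hn; rewrite mem_cat Hx.
  + by apply: Hs; rewrite mem_cat Hx.
  + by apply: Hn; rewrite mem_cat Hx orbT.
  + by apply: Hs; rewrite mem_cat Hx orbT.
- apply: (@Def_ext _ _ _ _ (fun k e => exists j u, (exists v, F v = (u, j)) /\
     sat (upd (nu k e) x (pre (u, j))) (mu k e) f)).
    move=> k e; split=> [[j [u [[v /preP ->] ?]]]|[v Hv]]; first by exists v.
    exists (F v).2, (F v).1; split; first by exists v; case: (F v).
    by rewrite -surjective_pairing (_ : pre _ = Some v) //; apply/preP.
  apply: Def_exfin => j.
  apply: (@Def_exN _ _ _ _ (fun k e u => (exists v, F v = (u, j)) /\
     sat (upd (nu k e) x (pre (u, j))) (mu k e) f)).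
  apply: Def_and; first exact: Hnode (Acc_last c).
  apply: (IH (extN c) (fun k e => upd (nu k e.1) x (pre (e.2, j))) (fun k e => mu k e.1)).
  + move=> y Hy; case: (eqVneq y x) => [->|yx].
      exists j, (fun k (e : env (extN c) k) => e.2); split; first exact: Acc_last.
      by move=> k e; rewrite upd_eq.
    have [|j' [t [Ht Hy']]] := Hn y; first by rewrite mem_filter yx.
    exists j', (fun k (e : env (extN c) k) => t k e.1); split; first exact: Acc_extN.
    by move=> k e; rewrite upd_neq.
  + move=> X HX j'; have [Z [HZ HX']] := Hs X HX j'.
    exists (fun k (e : env (extN c) k) => Z k e.1); split; first exact: SAcc_extN.
    by move=> k e v; apply: HX'.
- apply: (@Def_ext _ _ _ _ (fun k e => exists Z : C -> gV (Gr k) -> Prop,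
     sat (nu k e) (upd (mu k e) X (fun v => Z (F v).2 (F v).1)) f)).
    move=> k e; split=> [[Z HZ]|[P HP]]; first by exists (fun v => Z (F v).2 (F v).1).
    exists (fun j u => exists2 v, F v = (u, j) & P v).
    move: HP; congr (sat _ _ _); apply: funext => Y; rewrite /upd; case: eqP => // _.
    apply: funext => v; apply: propext; split=> [Pv|[v' Hv' Pv']]; first by exists v => //; case: (F v).
    by rewrite (@F_inj k v v') // Hv'; case: (F v).
  apply: (@Def_exF _ _ _ _ _ (fun k e Z => sat (nu k e) (upd (mu k e) X (fun v => Z (F v).2 (F v).1)) f)).
  apply: (IH (extF c C) (fun k e => nu k e.1) (fun k e => upd (mu k e.1) X (fun v => e.2 (F v).2 (F v).1))).
  + move=> y Hy; have [j [t [Ht Hx]]] := Hn y Hy.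
    exists j, (fun k (e : env (extF c C) k) => t k e.1); split; first exact: Acc_extF.
    by move=> k e; rewrite Hx.
  + move=> Y HY j; case: (eqVneq Y X) => [->|YX].
      exists (fun k (e : env (extF c C) k) => e.2 j); split; first exact: SAcc_last.
      by move=> k e v <-; rewrite upd_eq.
    have [|Z [HZ HX]] := Hs Y _ j; first by rewrite mem_filter YX.
    exists (fun k (e : env (extF c C) k) => Z k e.1); split; first exact: SAcc_extF.
    by move=> k e v; rewrite upd_neq //; apply: HX.
Qed.

End Backward.

Section Substitution.
Variables (A K : Type) (Gr : K -> graph unit A).

(** The identity coding, with one copy, as an instance of the backward translation: it substitutes
    accessible terms for the free node variables of a formula without any care for variable
    capture. *)
Lemma Def_subst (f : mso unit A) (c : ctx Gr)
  (nu : forall k, env c k -> nat -> option (gV (Gr k)))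
  (mu : forall k, env c k -> nat -> gV (Gr k) -> Prop) :
  {in fv_node f, forall x, exists t, Acc t /\ forall k e, nu k e x = Some (t k e)} ->
  fv_set f = [::] ->
  @Def _ _ _ c (fun k e => sat (nu k e) (mu k e) f).
Proof.
move=> Hn Hs; apply: (@Def_backward _ _ _ Gr Gr unit (fun k v => (v, tt))).
- by move=> k u v [].
- by move=> c' t [] _; apply: (Def_ext _ (Def_const c' True)) => k e; split=> // _; exists (t k e).
- move=> c' t t' [] [] a Ht Ht'; apply: Def_ext (Def_edge a Ht Ht') => k e.
  by split=> [H|[u [v [[->] [[->]]]]]//]; exists (t k e), (t' k e).
- move=> x /Hn[t [Ht H]]; exists tt, t; split=> // k e; rewrite H.
  case: pickP => [v /eqP[->]//|/(_ (t k e))]; by rewrite eqxx.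
- by move=> X; rewrite Hs.
Qed.

Definition Def0 (P : K -> Prop) := @Def _ _ _ (c0 Gr) (fun k _ => P k).
Definition Def1 (P : forall k, gV (Gr k) -> Prop) :=
  @Def _ _ _ (extN (c0 Gr)) (fun k e => P k e.2).
Definition Def2 (P : forall k, gV (Gr k) -> gV (Gr k) -> Prop) :=
  @Def _ _ _ (extN (extN (c0 Gr))) (fun k e => P k e.1.2 e.2).

Lemma all_lt0 s : all (fun x => x < 0) s -> s = [::].
Proof. by case: s. Qed.

Lemma all_lt1 s : all (fun x => x < 1) s -> all (fun x => x == 0) s.
Proof. by apply: sub_all => -[]. Qed.

Lemma all_lt2 s : all (fun x => x < 2) s -> all (fun x => (x == 0) || (x == 1)) s.
Proof. by apply: sub_all => -[|[]]. Qed.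

End Substitution.

Section Reindex.
Variables (A K : Type) (Gr : K -> graph unit A) (K' : Type) (rho : K' -> K).
Local Notation Gr' := (fun k => Gr (rho k)).

(** The formula does not mention the index, so it also defines the property along any map of
    indices. *)
Lemma Def0_reindex (c : ctx Gr') P : Def0 Gr P -> @Def _ _ Gr' c (fun k e => P (rho k)).
Proof.
move=> [f [Hn [/all_lt0 Hs Hf]]].
apply: Def_ext (@Def_subst _ _ _ f c (fun k e => @nu0 _) (fun k e => @mu0 _) _ Hs) => [k e|x].
  exact: (Hf (rho k) tt).
by rewrite (all_lt0 Hn).
Qed.

Lemma Def1_reindex (c : ctx Gr') P t : Def1 P -> Acc t ->
  @Def _ _ Gr' c (fun k e => P (rho k) (t k e)).
Proof.
move=> [f [/all_lt1/allP Hn [/all_lt0 Hs Hf]]] Ht.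
apply: Def_ext (@Def_subst _ _ _ f c (fun k e => nu1 (t k e)) (fun k e => @mu0 _) _ Hs) => [k e|x].
  exact: (Hf (rho k) (tt, t k e)).
by move=> /Hn/eqP->; exists t.
Qed.

Lemma Def2_reindex (c : ctx Gr') P t t' : Def2 P -> Acc t -> Acc t' ->
  @Def _ _ Gr' c (fun k e => P (rho k) (t k e) (t' k e)).
Proof.
move=> [f [/all_lt2/allP Hn [/all_lt0 Hs Hf]]] Ht Ht'.
apply: Def_ext (@Def_subst _ _ _ f c (fun k e => nu2 (t k e) (t' k e)) (fun k e => @mu0 _) _ Hs) => [k e|x].
  exact: (Hf (rho k) (tt, t k e, t' k e)).
by move=> /Hn/orP[]/eqP->; [exists t|exists t'].
Qed.
End Reindex.

(** * Walks in labelled graphs *)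

Section Walks.
Variables (X L : Type) (E : X -> L -> X -> Prop).

Fixpoint walk (x : X) (z : seq L) (y : X) : Prop :=
  if z is b :: z' then exists2 x', E x b x' & walk x' z' y else x = y.

Lemma walk_cat x z1 z2 y : walk x (z1 ++ z2) y <-> exists2 x', walk x z1 x' & walk x' z2 y.
Proof.
elim: z1 x => [|b z IH] x /=; first by split=> [H|[x' ->]]; first by exists x.
split=> [[x1 H1 /IH[x2 H2 H3]]|[x2 [x1 H1 H2] H3]]; first by exists x2 => //; exists x1.
by exists x1 => //; apply/IH; exists x2.
Qed.

Lemma walk1 x b y : walk x [:: b] y <-> E x b y.
Proof. by split=> [[? ? <-]|H] //; exists y. Qed.

Lemma walk_rcons x z b y : walk x (rcons z b) y <-> exists2 x', walk x z x' & E x' b y.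
Proof. by rewrite -cats1 walk_cat; split=> -[x' H1 /walk1 H2]; exists x'. Qed.

(** Reachability as membership in every closed set around the source: the form that monadic logic
    can express. *)
Lemma reachP x y : (exists z, walk x z y) <->
  forall Z : X -> Prop, Z x -> (forall u b v, Z u -> E u b v -> Z v) -> Z y.
Proof.
split=> [[z]|H].
- elim: z x => [x <- //|b z IH x [x1 H1 H2] Z Zx HZ]; apply: (IH x1 H2 Z _ HZ); exact: HZ H1.
- apply: (H (fun v => exists z, walk x z v)); first by exists [::].
  by move=> u b v [z Hz] Huv; exists (rcons z b); apply/walk_rcons; exists u.
Qed.

Hypothesis E_det : forall x b y b' y', E x b y -> E x b' y' -> b = b' /\ y = y'.

Lemma walk_stuck_unique x l l' z z' : (forall b y, ~ E l b y) -> (forall b y, ~ E l' b y) ->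
  walk x z l -> walk x z' l' -> z = z'.
Proof.
move=> Hl Hl'; elim: z x z' => [|b z IH] x [|b' z'] //=.
- by move=> -> [y /Hl].
- by move=> [y Hy _] E0; move: Hy; rewrite E0 => /Hl'.
- move=> [y Hy H] [y' Hy' H']; have [-> Hyy] := E_det Hy Hy'.
  by congr cons; apply: IH H _; rewrite Hyy.
Qed.

(** In a deterministic graph a walk that ends in a stuck vertex cannot repeat a vertex, and nothing
    else is reachable from its origin. So the reachable part is a copy of [ed z]; this is how walks
    become output graphs. *)
Lemma det_path r z l : (forall b y, ~ E l b y) -> walk r z l ->
  exists f : 'I_(size z).+1 -> X,
    [/\ injective f, f ord0 = r, f ord_max = l,
        forall x, (exists z', walk r z' x) <-> exists i, f i = x &
        forall i b j, E (f i) b (f j) <-> (j : nat) = i.+1 /\ onth z i = Some b].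
Proof.
move=> Hl Hw.
have [p [p0 pn Hp]] : exists p : nat -> X, [/\ p 0 = r, p (size z) = l &
    forall i, i < size z -> exists2 b, onth z i = Some b & E (p i) b (p i.+1)].
  elim: z r Hw => [r <-|b z IH r [x H1 /IH[p [p0 pn Hp]]]] /=; first by exists (fun _ => r).
  exists (fun i => if i is i'.+1 then p i' else r); split=> // -[_|i Hi] /=.
    by exists b => //; rewrite p0.
  exact: Hp.
(* If the walk met the same vertex at times [i < j], determinism would keep it equal at times
   [i + k] and [j + k]. For [k = size z - j] the stuck vertex [l] would be met before the end, where
   an edge leaves it. *)
have p_inj i j : i < j -> j <= size z -> p i <> p j.
  move=> ij jn pij.
  have Hk k : j + k <= size z -> p (i + k) = p (j + k).
    elim: k => [|k IH] Hk; first by rewrite !addn0.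
    rewrite !addnS in Hk *.
    have [b _ H1] := Hp _ Hk.
    have Hik : i + k < size z by apply: leq_trans (ltnW Hk); rewrite ltn_add2r.
    have [b' _ H2] := Hp _ Hik.
    by rewrite (IH (ltnW Hk)) in H2; have [_ ->] := E_det H1 H2.
  have Hin : i + (size z - j) < size z.
    by rewrite -[X in _ < X](subnKC jn) ltn_add2r.
  have [b _] := Hp _ Hin.
  by rewrite Hk subnKC // pn => /Hl.
have p_inj' i j : i <= size z -> j <= size z -> p i = p j -> i = j.
  move=> Hi Hj Hij; case: (ltngtP i j) => [H|H|->]; last by [].
    by case: (p_inj _ _ H Hj Hij).
  by case: (p_inj _ _ H Hi (esym Hij)).
exists (fun i => p i); split=> //.
- by move=> i j Hij; apply: val_inj; apply: p_inj' Hij; rewrite -ltnS ltn_ord.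
- move=> x; split=> [[z']|[i <-]].
  + have : walk r z' x -> exists i : 'I_(size z).+1, p i = x; last exact.
    rewrite -p0; have: 0 <= size z by [].
    elim: z' 0 => [|b z' IH] i Hi /=.
      by move=> <-; exists (Ordinal (Hi : i < (size z).+1)).
    move=> [x' H1 H2]; move: Hi; rewrite leq_eqVlt => /orP[/eqP Hi|Hi].
      by move: H1; rewrite Hi pn => /Hl.
    have [b' _ H3] := Hp _ Hi; have [_ Hx] := E_det H1 H3.
    by apply: (IH i.+1) => //; rewrite -Hx.
  + case: i => i /=; elim: i => [|i IH] Hi; first by exists [::].
    have [z' Hz'] := IH (ltnW Hi).
    have [b _ Hb] := Hp i Hi.
    by exists (rcons z' b); apply/walk_rcons; exists (p i).
- move=> [i Hi] b [j Hj] /=; split=> [H|[-> Hb]].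
  + move: Hi; rewrite ltnS leq_eqVlt => /orP[/eqP Hi|Hi]; first by move: H; rewrite Hi pn => /Hl.
    have [b' Hb' H'] := Hp i Hi; have [-> Hx] := E_det H H'.
    by split=> //; apply: p_inj'.
  + have Hi' : i < size z by rewrite -onthTE Hb.
    by have [b' Hb' H'] := Hp i Hi'; move: Hb; rewrite Hb' => -[<-].
Qed.

End Walks.

Section BackwardUnary.
Variables (A B K KB : Type) (Gr : K -> graph unit A) (Hr0 : KB -> graph unit B) (sigma : K -> KB).
Local Notation Hr := (fun k => Hr0 (sigma k)).
Variables (C : finType) (F : forall k, gV (Hr k) -> gV (Gr k) * C).
Hypothesis F_inj : forall k, injective (@F k).
Hypothesis Hnode : forall (c : ctx Gr) t j, Acc t ->
  @Def _ _ _ c (fun k e => exists v, F v = (t k e, j)).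
Hypothesis Hedge : forall (c : ctx Gr) t t' j j' a, Acc t -> Acc t' ->
  @Def _ _ _ c (fun k e => exists v v', F v = (t k e, j) /\ F v' = (t' k e, j') /\ gE (Hr k) v a v').

Lemma pick_inj (k : K) p (v : gV (Hr k)) : F v = p -> [pick v | F v == p] = Some v.
Proof.
move=> Hv; case: pickP => [u /eqP Hu|/(_ v)]; last by rewrite Hv eqxx.
by congr Some; apply: (@F_inj k); rewrite Hv.
Qed.

Lemma Def0_backward (c : ctx Gr) P : Def0 Hr0 P -> @Def _ _ _ c (fun k e => P (sigma k)).
Proof.
move=> [f [/all_lt0 Hn [/all_lt0 Hs Hf]]].
apply: Def_ext (@Def_backward _ _ _ Gr Hr C F F_inj Hnode Hedge f c
  (fun k e => @nu0 _) (fun k e => @mu0 _) _ _) => [k e|x|x].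
- exact: (Hf (sigma k) tt).
- by rewrite Hn.
- by rewrite Hs.
Qed.

Lemma Def1_backward (c : ctx Gr) P t j : @Def1 _ _ Hr0 P -> Acc t ->
  @Def _ _ _ c (fun k e => exists2 v, F v = (t k e, j) & P (sigma k) v).
Proof.
move=> [f [/all_lt1/allP Hn [/all_lt0 Hs Hf]]] Ht.
apply: Def_ext (Def_and (Hnode j Ht) (@Def_backward _ _ _ Gr Hr C F F_inj Hnode Hedge f c
  (fun k e => upd (@nu0 _) 0 [pick v | F v == (t k e, j)]) (fun k e => @mu0 _) _ _)) => [k e|x|x].
- split=> [[[v Hv]]|[v Hv HP]]; [rewrite (pick_inj Hv) => HP; exists v => //|split; first by exists v].
    exact/(Hf (sigma k) (tt, v)).
  by rewrite (pick_inj Hv); apply/(Hf (sigma k) (tt, v)).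
- by move=> /Hn/eqP->; exists j, t; split=> // k e; rewrite upd_eq.
- by rewrite Hs.
Qed.

Lemma Def2_backward (c : ctx Gr) P t t' j j' : @Def2 _ _ Hr0 P -> Acc t -> Acc t' ->
  @Def _ _ _ c (fun k e => exists v v', F v = (t k e, j) /\ F v' = (t' k e, j') /\ P (sigma k) v v').
Proof.
move=> [f [/all_lt2/allP Hn [/all_lt0 Hs Hf]]] Ht Ht'.
apply: Def_ext (Def_and (Hnode j Ht) (Def_and (Hnode j' Ht')
  (@Def_backward _ _ _ Gr Hr C F F_inj Hnode Hedge f c
  (fun k e => upd (upd (@nu0 _) 0 [pick v | F v == (t k e, j)]) 1 [pick v | F v == (t' k e, j')])
  (fun k e => @mu0 _) _ _))) => [k e|x|x].
- split=> [[[v Hv] [[v' Hv']]]|[v [v' [Hv [Hv' HP]]]]].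
    rewrite (pick_inj Hv) (pick_inj Hv') => HP; exists v, v'; do 2!split=> //.
    exact/(Hf (sigma k) (tt, v, v')).
  split; [by exists v|split; first by exists v'].
  by rewrite (pick_inj Hv) (pick_inj Hv'); apply/(Hf (sigma k) (tt, v, v')).
- by move=> /Hn/orP[]/eqP->; [exists j, t|exists j', t'].
- by rewrite Hs.
Qed.
End BackwardUnary.

(** * MSO definable string transductions *)

Section ContextLemmas.
Variables (A K : Type) (Gr : K -> graph unit A).

Lemma Acc_weakenN (c : ctx Gr) t (t' : forall k, env (extN c) k -> gV (Gr k)) :
  (forall k e u, t' k (e, u) = t k e) -> Acc t -> Acc t'.
Proof. by move=> H /Acc_extN[x [Hx Hf]]; exists x; split=> // k [e u]; rewrite H Hf. Qed.

Lemma Acc_weakenF (c : ctx Gr) (J : finType) t (t' : forall k, env (extF c J) k -> gV (Gr k)) :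
  (forall k e Z, t' k (e, Z) = t k e) -> Acc t -> Acc t'.
Proof. by move=> H /(@Acc_extF _ _ _ _ J)[x [Hx Hf]]; exists x; split=> // k [e u]; rewrite H Hf. Qed.

Lemma SAcc_weakenN (c : ctx Gr) t (t' : forall k, env (extN c) k -> gV (Gr k) -> Prop) :
  (forall k e u, t' k (e, u) = t k e) -> SAcc t -> SAcc t'.
Proof. by move=> H /SAcc_extN[x [Hx Hf]]; exists x; split=> // k [e u]; rewrite H Hf. Qed.

Lemma SAcc_weakenF (c : ctx Gr) (J : finType) t (t' : forall k, env (extF c J) k -> gV (Gr k) -> Prop) :
  (forall k e Z, t' k (e, Z) = t k e) -> SAcc t -> SAcc t'.
Proof. by move=> H /(@SAcc_extF _ _ _ _ J)[x [Hx Hf]]; exists x; split=> // k [e u]; rewrite H Hf. Qed.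

End ContextLemmas.

(** Finds the variable holding a term by peeling extensions off the context, until the term is the
    variable bound last or an assumption applies. *)
Ltac acc := lazymatch goal with
  | |- @Acc _ _ _ (extN _) _ =>
      first [exact (Acc_last _) | eapply Acc_weakenN; [intros; cbn; reflexivity | acc]]
  | |- @Acc _ _ _ (extF _ _) _ => eapply Acc_weakenF; [intros; cbn; reflexivity | acc]
  | |- @Acc _ _ _ _ _ => solve [auto]
  end.

Ltac sacc := lazymatch goal with
  | |- @SAcc _ _ _ (extF _ _) _ =>
      first [exact (SAcc_last _ _) | eapply SAcc_weakenF; [intros; cbn; reflexivity | sacc]]
  | |- @SAcc _ _ _ (extN _) _ => eapply SAcc_weakenN; [intros; cbn; reflexivity | sacc]
  | |- @SAcc _ _ _ _ _ => solve [auto]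
  end.

(** One step of a syntax-directed proof of definability. The type of a bound variable selects the
    rule: a node quantifier, a block of set quantifiers, or a finite disjunction or conjunction. *)
Ltac def1 := lazymatch goal with
  | |- @Def _ _ _ _ (fun k e => exists v : Finite.sort (gV _), _) => eapply Def_exN
  | |- @Def _ _ _ _ (fun k e => forall v : Finite.sort (gV _), _) => eapply Def_allN
  | |- @Def _ _ _ _ (fun k e => exists Z : (_ -> Finite.sort (gV _) -> Prop), _) => eapply Def_exF
  | |- @Def _ _ _ _ (fun k e => forall Z : (_ -> Finite.sort (gV _) -> Prop), _) => eapply Def_allF
  | |- @Def _ _ _ _ (fun k e => _ <-> _) => eapply Def_iff
  | |- @Def _ _ _ _ (fun k e => _ /\ _) => eapply Def_and
  | |- @Def _ _ _ _ (fun k e => _ \/ _) => eapply Def_or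
  | |- @Def _ _ _ _ (fun k e => ~ _) => eapply Def_not
  | |- @Def _ _ _ _ (fun k e => gE _ _ _ _) => eapply Def_edge; acc
  | |- @Def _ _ _ _ (fun k e => @eq (Finite.sort (gV _)) _ _) => eapply Def_eq; acc
  | |- @Def _ _ _ _ (fun k e => _ = _) => eapply Def_const
  | |- @Def _ _ _ _ (fun k e => is_true _) => exact: Def_const
  | |- @Def _ _ _ _ (fun k e => exists j : _, _) => eapply Def_exfin; intro
  | |- @Def _ _ _ _ (fun k e => forall j : Finite.sort _, _) => eapply Def_allfin; intro
  | |- @Def _ _ _ _ (fun k e => _ -> _) => eapply Def_imp
  (* Membership in a set variable; second-order patterns cannot split the application. *)
  | |- @Def _ _ _ ?c ?P =>
      let Z := constr:(fun index (environment : env c index) =>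
        ltac:(let b := eval cbv beta in (P index environment) in
              lazymatch b with ?f ?x => exact f end)) in
      let t := constr:(fun index (environment : env c index) =>
        ltac:(let b := eval cbv beta in (P index environment) in
              lazymatch b with ?f ?x => exact x end)) in
      eapply (@Def_in _ _ _ c t Z); [acc|sacc]
  end; cbn beta.

Section Isomorphisms.
Variables (S G : Type).

Lemma giso_inv (g h : graph S G) : giso g h -> exists F F', [/\ cancel F F', cancel F' F,
  (forall v, glab h (F v) = glab g v) & (forall u a v, gE g u a v <-> gE h (F u) a (F v))].
Proof. by move=> [F [[F' FK F'K] [H1 H2]]]; exists F, F'. Qed.

Lemma giso_refl (g : graph S G) : giso g g.
Proof. by exists id; split=> //; exists id. Qed.

Lemma giso_sym (g h : graph S G) : giso g h -> giso h g.
Proof.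
move=> /giso_inv[F [F' [FK F'K H1 H2]]]; exists F'; split; first by exists F.
by split=> [v|u a v]; [rewrite -H1 F'K|rewrite H2 !F'K].
Qed.

Lemma sat_giso (g h : graph S G) f : giso g h ->
  sat (g := g) (@nu0 _) (@mu0 _) f <-> sat (g := h) (@nu0 _) (@mu0 _) f.
Proof. by move=> /giso_inv[F [F' [FK F'K H1 H2]]]; exact: (sat_iso f _ _ FK F'K H1 H2). Qed.
End Isomorphisms.

Section Outputs.
Variables (S G G' : Type).

Lemma out_nodeE (T : msot S G unit G') g u c :
  out_node T g u c <-> sat (nu1 u) (@mu0 _) (t_node T c tt).
Proof. by split=> [[[] []]//|H]; exists tt; split=> // -[]. Qed.

(** A domain formula does not by itself supply an output. That one always exists, on the pairs
    satisfying [out_node], is what ties [t_dom] to the domain of the transduction in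
    [MSOed_string]. *)
Lemma output_exists (T : msot S G unit G') g : exists h, is_output T g h.
Proof.
exists (@Graph unit G' {p : gV g * t_C T | `[< out_node T g p.1 p.2 >]}
  (fun x a y => sat (nu2 (val x).1 (val y).1) (@mu0 _) (t_edge T (val x).2 (val y).2 a)) (fun _ => tt)).
exists val; split; first exact: val_inj.
do 2!split=> //.
- move=> H; have Hp : `[< out_node T g p.1 p.2 >] by apply/asboolP.
  by exists (exist _ p Hp).
- by move=> [v <-]; apply/asboolP; exact: (valP v).
- by move=> v; apply/out_nodeE/asboolP; exact: (valP v).
Qed.

(** Both graphs enumerate the same set of pairs without repetition; matching equal pairs is the
    isomorphism. *)
Lemma output_unique (T : msot S G unit G') g h h' : is_output T g h -> is_output T g h' -> giso h h'.
Proof.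
move=> [f [fi [fn [fl fe]]]] [f' [fi' [fn' [fl' fe']]]].
have [F HF] : {F & forall v, f' (F v) = f v}.
  by apply: (@choice _ _ (fun v u => f' u = f v)) => v; apply/fn'/fn; exists v.
have [F' HF'] : {F' & forall v, f (F' v) = f' v}.
  by apply: (@choice _ _ (fun v u => f u = f' v)) => v; apply/fn/fn'; exists v.
exists F; split; first by exists F' => v; [apply: fi|apply: fi']; rewrite ?HF ?HF' ?HF.
split=> [v|u a v]; first by case: (glab _ _) (glab _ _) => -[].
by rewrite fe fe' !HF.
Qed.

Lemma is_output_isor (T : msot S G unit G') g h h' : giso h h' -> is_output T g h -> is_output T g h'.
Proof.
move=> /giso_inv[F [F' [FK F'K H1 H2]]] [f [fi [fn [fl fe]]]].
exists (f \o F'); split; first exact: inj_comp fi (can_inj F'K).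
split=> [p|].
  by rewrite fn; split=> -[v <-]; [exists (F v); rewrite /= FK|exists (F' v)].
split=> [v|u a v] /=; first by have := fl (F' v); rewrite -H1 F'K.
by rewrite -fe H2 !F'K.
Qed.

Lemma is_output_isol (T : msot S G unit G') g g' h : giso g g' -> is_output T g h -> is_output T g' h.
Proof.
move=> /giso_inv[F [F' [FK F'K H1 H2]]] [f [fi [fn [fl fe]]]].
have Hn u f0 : sat (g := g) (nu1 u) (@mu0 _) f0 <-> sat (g := g') (nu1 (F u)) (@mu0 _) f0.
  rewrite (sat_iso f0 _ _ FK F'K H1 H2) (_ : (fun x => _) = nu1 (F u)) //.
  by apply: funext => -[].
have He u v f0 : sat (g := g) (nu2 u v) (@mu0 _) f0 <-> sat (g := g') (nu2 (F u) (F v)) (@mu0 _) f0.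
  rewrite (sat_iso f0 _ _ FK F'K H1 H2) (_ : (fun x => _) = nu2 (F u) (F v)) //.
  by apply: funext => -[|[]].
exists (fun v => (F (f v).1, (f v).2)); split.
  move=> u v [/(can_inj FK) E1 E2]; apply: fi.
  by rewrite [LHS]surjective_pairing E1 E2 -surjective_pairing.
split=> [[u c]|].
  have -> : out_node T g' u c <-> out_node T g (F' u) c by rewrite !out_nodeE Hn F'K.
  rewrite (fn (F' u, c)); split=> -[v]; first by move=> E; exists v; rewrite E /= F'K.
  by move=> [<- <-]; exists v; rewrite FK -surjective_pairing.
by split=> [v|u a v] /=; [rewrite -Hn|rewrite -He].
Qed.
End Outputs.

(** An isomorphism of paths preserves positions, by induction from the first node; the edge labels
    then agree position by position. *)
Lemma ed_giso (A : Type) (z z' : seq A) : giso (ed z) (ed z') -> z = z'.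
Proof.
move=> /giso_inv[F [F' [FK F'K _ HE]]]; rewrite /= in F F' FK F'K HE.
have Hs : size z = size z'.
  have := bij_eq_card (Bijective FK F'K); by rewrite !card_ord => -[].
have HF i : forall Hi : i < (size z).+1, F (Ordinal Hi) = i :> nat.
  elim: i => [|i IH] Hi.
    (* Node 0 has no incoming edge: a predecessor [k] of its image would be pulled back to a
       predecessor of node 0. *)
    case E0: (val (F (Ordinal Hi))) => [|k] //.
    have Hk : k < (size z').+1 by apply: ltnW; rewrite -E0 ltn_ord.
    have [a Ha] : exists a, onth z' k = Some a.
      have: k < size z' by rewrite -ltnS -E0 ltn_ord.
      by rewrite -onthTE; case: onth => // a _; exists a.
    have [] := (HE (F' (Ordinal Hk)) a (Ordinal Hi)).2 _; last by [].
    by rewrite F'K; split=> //.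
  have Hi' := ltnW Hi.
  have [a Ha] : exists a, onth z i = Some a.
    by move: Hi; rewrite ltnS -onthTE; case: onth => // a _; exists a.
  have [] := (HE (Ordinal Hi') a (Ordinal Hi)).1 _; first by [].
  by rewrite IH.
apply: eq_from_onth_le => i; rewrite -Hs maxnn => Hi.
have [a Ha] : exists a, onth z i = Some a by move: Hi; rewrite -onthTE; case: onth => // a _; exists a.
have Hi1 : i < (size z).+1 by rewrite ltnW.
have Hi2 : i.+1 < (size z).+1 by [].
have [] := (HE (Ordinal Hi1) a (Ordinal Hi2)).1 _; first by [].
by rewrite !HF Ha => _ ->.
Qed.

Section StringGraphs.
Variable A : finType.

(** A monadic axiomatization of paths: at most one edge leaves each node, some node reaches all
    nodes, and some node has no outgoing edge. Absence of cycles is not stated; it follows through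
    [det_path]. The index [unit] gives the single set the shape of a family, as set quantifiers
    require. *)
Definition string_graph (g : graph unit A) :=
  (forall u : gV g, forall a, forall v : gV g, forall a', forall v' : gV g,
     gE g u a v -> gE g u a' v' -> a = a' /\ v = v') /\
  exists r : gV g, exists l : gV g, (forall b, forall y : gV g, ~ gE g l b y) /\
    forall v : gV g, forall Z : unit -> gV g -> Prop, Z tt r ->
      (forall u : gV g, forall b, forall v : gV g, Z tt u -> gE g u b v -> Z tt v) -> Z tt v.

Lemma Def_string_graph : Def0 (fun g : graph unit A => g) string_graph.
Proof.
rewrite /Def0 /string_graph; repeat def1.
Qed.

Lemma ed_string_graph w : string_graph (ed w).
Proof.
split=> [u a v a' v' [H1 H2] [H1' H2']|].
  by split; [move: H2; rewrite H2' => -[->]|apply: ord_inj; rewrite H1 H1'].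
exists ord0, ord_max; split=> [b y []|].
  by move=> _; rewrite onth_default.
move=> [v Hv] Z Z0 HZ; elim: v Hv => [|v IH] Hv; first by rewrite (_ : Ordinal Hv = ord0) //; apply: val_inj.
have [a Ha] : exists a, onth w v = Some a.
  by move: (Hv); rewrite ltnS -onthTE; case: onth => // a _; exists a.
by apply: (HZ (Ordinal (ltnW Hv)) a) => //; exact: IH.
Qed.

Lemma string_graphP (g : graph unit A) : string_graph g <-> exists w, giso g (ed w).
Proof.
split=> [[Hd [r [l [Hl Hr]]]]|[w Hw]].
  have Hreach v : exists z, walk (@gE _ _ g) r z v.
    by apply/reachP => Z Zr HZ; apply: (Hr v (fun _ => Z)).
  have [w Hw] := Hreach l.
  have [f [fi f0 fl fr fe]] := @det_path _ _ _ (fun x b y b' y' => @Hd x b y b' y') _ _ _ Hl Hw.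
  have [f' f'K] : {f' & forall x, f (f' x) = x} by apply: (@choice _ _ (fun x i => f i = x)) => x; apply/fr/Hreach.
  exists w; apply: giso_sym; exists f; split; first by exists f' => // v; apply: fi.
  split=> [v|u a v]; [by case: (glab _ _); case: (glab _ _)|by rewrite fe].
(* The converse is checked on [ed w] only: being given by a formula, the property is invariant under
   isomorphism. *)
have [f [_ [_ Hf]]] := Def_string_graph.
by apply/(Hf g tt)/(sat_giso _ Hw)/(Hf (ed w) tt)/ed_string_graph.
Qed.
End StringGraphs.

(* [MSOed] with the formulas evaluated on the graphs [ed w] only. *)
Definition string_mso (A B : finType) (m : transduction A B) :=
  functional m /\ exists (C : finType) (N : C -> forall w : seq A, gV (ed w) -> Prop)
    (E : C -> C -> B -> forall w : seq A, gV (ed w) -> gV (ed w) -> Prop),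
  [/\ Def0 (@ed A) (fun w => exists z, m w z),
      forall c, Def1 (N c), forall c c' b, Def2 (E c c' b) &
      forall w z, m w z -> exists f : gV (ed z) -> gV (ed w) * C,
        [/\ injective f, forall p, N p.2 w p.1 <-> exists v, f v = p &
            forall v b v', gE (ed z) v b v' <-> E (f v).2 (f v').2 b w (f v).1 (f v').1]].

Section StringMSO.
Variables (A B : finType) (m : transduction A B).

Lemma MSOed_string : MSOed m -> string_mso m.
Proof.
move=> [T [[wd [ws [wn we]]] HT]].
have Hout w z : m w z -> msot_rel T (ed w) (ed z).
  by move=> H; apply/HT; exists w, z; split=> //; split; exact: giso_refl.
have wn1 c s : all (fun x => x < 1) (fv_node (t_node T c s)).
  by have [/sub_all H _] := wn c s; apply: H => -[].
have we1 c c' s : all (fun x => x < 2) (fv_node (t_edge T c c' s)).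
  by have [/sub_all H _] := we c c' s; apply: H => -[|[|?]].
split.
  move=> w z1 z2 /Hout[_ H1] /Hout[_ H2]; apply: ed_giso; exact: output_unique H1 H2.
exists (t_C T), (fun c w u => sat (nu1 u) (@mu0 _) (t_node T c tt)),
  (fun c c' b w u v => sat (nu2 u v) (@mu0 _) (t_edge T c c' b)); split.
- exists (t_dom T); rewrite wd ws; split=> //; split=> // k e; split=> H; last first.
    by have [z /Hout[]] := H.
  (* If the domain formula holds on [ed k], some output graph exists, and the equivalence [HT] makes
     [ed k] isomorphic to the graph of a word in the domain, which is then [k] itself. *)
  have [h Hh] := output_exists T (ed k).
  have [w [z [Hm [Hw _]]]] := (HT (ed k) h).2 (conj H Hh).
  by rewrite (ed_giso Hw); exists z.
- by move=> c; exists (t_node T c tt); have [_ ->] := wn c tt.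
- by move=> c c' b; exists (t_edge T c c' b); have [_ ->] := we c c' b.
- move=> w z /Hout[_ [f [fi [fn [fl fe]]]]]; exists f; split=> // p.
  by rewrite -fn out_nodeE.
Qed.

Lemma string_MSOed : string_mso m -> MSOed m.
Proof.
move=> [mf [C [N [E [[f0 [H01 [H02 H0]]] HN HE Hm]]]]].
have [fN HfN] := choice HN.
have [fE HfE] := choice (fun p : C * C * B => HE p.1.1 p.1.2 p.2).
have [fS [Hs1 [Hs2 Hs]]] := Def_string_graph A.
(* The given formulas are only controlled on graphs [ed w], whereas inputs range over all graphs; so
   the domain formula also tests for a path. *)
pose T := @Msot unit A unit B C (FAnd fS f0) (fun c _ => fN c) (fun c c' b => fE (c, c', b)).
have HsN c w (u : gV (ed w)) : sat (nu1 u) (@mu0 _) (fN c) <-> N c w u.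
  have [_ [_ H]] := HfN c; exact: (H w (tt, u)).
have HsE c c' b w (u v : gV (ed w)) : sat (nu2 u v) (@mu0 _) (fE (c, c', b)) <-> E c c' b w u v.
  have [_ [_ H]] := HfE (c, c', b); exact: (H w (tt, u, v)).
have Hout w z : m w z -> is_output T (ed w) (ed z).
  move=> /Hm[f [fi fn fe]]; exists f; split=> //; split=> [p|].
    by rewrite out_nodeE /= HsN fn.
  split=> [v|v b v']; first by rewrite /= HsN; apply/(fn (f v)); exists v.
  by rewrite fe /= HsE.
exists T; split.
- split; first by rewrite /= (all_lt0 Hs1) (all_lt0 H01).
  split; first by rewrite /= (all_lt0 Hs2) (all_lt0 H02).
  split=> [c s|c c' b] /=.
    by have [/all_lt1 H [/all_lt0 H' _]] := HfN c.
  by have [/all_lt2 H [/all_lt0 H' _]] := HfE (c, c', b).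
- move=> g h; split=> [[w [z [Hz [Hg Hh]]]]|[[Hsg H0g] Ho]].
  + split; first split.
    * by apply/(Hs g tt)/string_graphP; exists w.
    * by apply/(sat_giso _ Hg)/(H0 w tt); exists z.
    * apply: is_output_isor (giso_sym Hh) _; apply: is_output_isol (giso_sym Hg) _; exact: Hout.
  + have [w Hw] : exists w, giso g (ed w) by apply/string_graphP/(Hs g tt).
    have [z Hz] : exists z, m w z by apply/(H0 w tt)/(sat_giso _ Hw).
    exists w, z; do 2!split=> //.
    apply: output_unique Ho _; apply: is_output_isol (giso_sym Hw) _; exact: Hout.
Qed.
End StringMSO.

(** * Closure under composition *)

Section Composition.
Variables (A B C : finType) (m1 : transduction A B) (m2 : transduction B C).

Lemma string_mso_comp : string_mso m1 -> string_mso m2 -> string_mso (tcomp m1 m2).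
Proof.
move=> [f1 [C1 [N1 [E1 [D1 HN1 HE1 Hm1]]]]] [f2 [C2 [N2 [E2 [D2 HN2 HE2 Hm2]]]]].
(* Indexing by the pairs of [m1] makes the input graph and the intermediate graph both functions of
   the index, as the backward translation requires. *)
pose K := {p : seq A * seq B | m1 p.1 p.2}.
pose rho (k : K) := (sval k).1; pose sigma (k : K) := (sval k).2.
pose Gr (k : K) := ed (rho k).
have HF (k : K) := cid (Hm1 _ _ (proj2_sig k)).
pose F (k : K) : gV (ed (sigma k)) -> gV (Gr k) * C1 := sval (HF k).
have F_inj k : injective (@F k) by case: (svalP (HF k)).
have F_node (k : K) p : N1 p.2 (rho k) p.1 <-> exists v, F k v = p by case: (svalP (HF k)).
have F_edge (k : K) v b v' : gE (ed (sigma k)) v b v' <->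
  E1 (F k v).2 (F k v').2 b (rho k) (F k v).1 (F k v').1 by case: (svalP (HF k)).
have Hnode (c : ctx Gr) t j : Acc t -> @Def _ _ _ c (fun k e => exists v, F k v = (t k e, j)).
  move=> Ht; apply: Def_ext (@Def1_reindex _ _ _ _ rho c _ _ (HN1 j) Ht) => k e.
  exact: (F_node k (t k e, j)).
have Hedge (c : ctx Gr) t t' j j' a : Acc t -> Acc t' -> @Def _ _ _ c (fun k e => exists v v',
    F k v = (t k e, j) /\ F k v' = (t' k e, j') /\ gE (ed (sigma k)) v a v').
  move=> Ht Ht'; apply: Def_ext (Def_and (Hnode c t j Ht) (Def_and (Hnode c t' j' Ht')
    (@Def2_reindex _ _ _ _ rho c _ _ _ (HE1 j j' a) Ht Ht'))) => k e.
  split=> [[[v Hv] [[v' Hv'] H]]|[v [v' [Hv [Hv' H]]]]].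
    by exists v, v'; do 2!split=> //; rewrite F_edge Hv Hv'.
  by split; [exists v|split; [exists v'|move: H; rewrite F_edge Hv Hv']].
have [g0 [H01 [H02 H0]]] := @Def0_backward _ _ _ _ Gr (@ed B) sigma C1 F F_inj Hnode Hedge (c0 Gr) _ D2.
have [gN HgN] := choice (fun p : C1 * C2 =>
  @Def1_backward _ _ _ _ Gr (@ed B) sigma C1 F F_inj Hnode Hedge (extN (c0 Gr)) _ _ p.1 (HN2 p.2) (Acc_last _)).
have [gE' HgE] := choice (fun p : C1 * C2 * (C1 * C2) * C =>
  @Def2_backward _ _ _ _ Gr (@ed B) sigma C1 F F_inj Hnode Hedge (extN (extN (c0 Gr))) _ _ _
    p.1.1.1 p.1.2.1 (HE2 p.1.1.2 p.1.2.2 p.2) (Acc_extN (Acc_last _)) (Acc_last _)).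
split; first by move=> w z z' [y [H1 H2]] [y' [H1' H2']]; move: H2'; rewrite -(f1 _ _ _ H1 H1'); exact: f2.
exists (C1 * C2)%type, (fun c w u => sat (nu1 u) (@mu0 _) (gN c)),
  (fun c c' b w u v => sat (nu2 u v) (@mu0 _) (gE' (c, c', b))); split.
- have [g1 [H11 [H12 H1]]] := D1.
  (* [g0] is meaningful only on inputs for which [m1] has an image, hence the conjunction with
     [g1]. *)
  exists (FAnd g1 g0); rewrite /= !all_cat H01 H02 H11 H12; split=> //; split=> // k e; split.
    move=> [/(H1 k e)[y Hy] H2]; pose k' : K := exist _ (k, y) Hy.
    by have [z Hz] := (H0 k' tt).1 H2; exists z, y.
  move=> [z [y [Hy Hz]]]; pose k' : K := exist _ (k, y) Hy.
  by split; [apply/(H1 k e); exists y|apply/(H0 k' tt); exists z].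
- by move=> c; have [Ha [Hb _]] := HgN c; exists (gN c); do 2!split=> //.
- by move=> c c' b; have [Ha [Hb _]] := HgE (c, c', b); exists (gE' (c, c', b)); do 2!split=> //.
- move=> w z [y [Hy Hz]]; pose k : K := exist _ (w, y) Hy.
  have HsN c (u : gV (ed w)) : sat (nu1 u) (@mu0 _) (gN c) <->
      exists2 v, F k v = (u, c.1) & N2 c.2 y v.
    by have [_ [_ H]] := HgN c; exact: (H k (tt, u)).
  have HsE c c' b (u v : gV (ed w)) : sat (nu2 u v) (@mu0 _) (gE' (c, c', b)) <->
      exists x x', F k x = (u, c.1) /\ F k x' = (v, c'.1) /\ E2 c.2 c'.2 b y x x'.
    by have [_ [_ H]] := HgE (c, c', b); exact: (H k (tt, u, v)).
  have [f [fi fn fe]] := Hm2 _ _ Hz.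
  (* The coding is iterated: an output node is an intermediate node with a copy in [C2], and that
     node is an input node with a copy in [C1]. *)
  exists (fun v => ((F k (f v).1).1, ((F k (f v).1).2, (f v).2))); split.
  + move=> u v [Ea Eb Ec]; apply: fi; rewrite [LHS]surjective_pairing [RHS]surjective_pairing Ec.
    congr pair; apply: (F_inj k); by rewrite [LHS]surjective_pairing [RHS]surjective_pairing Ea Eb.
  + move=> [u [ca cb]] /=; rewrite HsN /=; split=> [[x Hx Hn]|[v [<- <- <-]]].
      have [v Hv] := (fn (x, cb)).1 Hn; by exists v; rewrite Hv /= Hx.
    by exists (f v).1; [rewrite -surjective_pairing|apply/fn; exists v; case: (f v)].
  + move=> v b v'; rewrite fe HsE /=; split=> [H|[x [x' []]]].
      by exists (f v).1, (f v').1; rewrite -!surjective_pairing.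
    by rewrite -surjective_pairing => /F_inj<- [] /=; rewrite -surjective_pairing => /F_inj<-.
Qed.
End Composition.

(** * Recognizability of MSO definable sets of words *)

(* The alphabet may be infinite and [mul] need not be associative: only the
   finiteness of [M] matters. *)
Definition recognizes (S : Type) (M : finType) (mul : M -> M -> M) (h : seq S -> M) :=
  forall x y, h (x ++ y) = mul (h x) (h y).

Definition Rec (S : Type) (L : seq S -> Prop) :=
  exists (M : finType) (mul : M -> M -> M) (h : seq S -> M), recognizes mul h /\
    exists F : M -> Prop, forall x, L x <-> F (h x).

Section Recognizable.
Variable S : Type.
Implicit Types L : seq S -> Prop.

Lemma Rec_ext L L' : (forall x, L x <-> L' x) -> Rec L -> Rec L'.
Proof.
move=> H [M [mul [h [Hh [F HF]]]]]; exists M, mul, h; split=> //; exists F => x.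
by rewrite -H.
Qed.

Lemma Rec_not L : Rec L -> Rec (fun x => ~ L x).
Proof.
move=> [M [mul [h [Hh [F HF]]]]]; exists M, mul, h; split=> //; exists (fun m => ~ F m) => x.
by rewrite HF.
Qed.

(** A product of the individual multiplications. With one common value per word, a single annotation
    can later serve all formulas of a transduction. *)
Lemma Rec_family (I : finType) (L : I -> seq S -> Prop) : (forall i, Rec (L i)) ->
  exists (M : finType) (mul : M -> M -> M) (h : seq S -> M), recognizes mul h /\
    exists F : I -> M -> Prop, forall i x, L i x <-> F i (h x).
Proof.
move=> HL; suff [M [mul [h [Hh HF]]]] : exists (M : finType) (mul : M -> M -> M) (h : seq S -> M),
    recognizes mul h /\ {in enum I, forall i, exists F : M -> Prop, forall x, L i x <-> F (h x)}.
  exists M, mul, h; split=> //.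
  have [i|F HF'] := @choice I (M -> Prop) (fun i F => forall x, L i x <-> F (h x)).
    by apply: HF; rewrite mem_enum.
  by exists F.
elim: (enum I) => [|i s [M [mul [h [Hh HF]]]]].
  by exists unit, (fun _ _ => tt), (fun _ => tt).
have [M' [mul' [h' [Hh' [F' HF']]]]] := HL i.
exists (M' * M)%type, (fun p q => (mul' p.1 q.1, mul p.2 q.2)), (fun x => (h' x, h x)); split.
  by move=> x y; rewrite Hh Hh'.
move=> j; rewrite inE => /orP[/eqP->|/HF[F HFj]]; first by exists (fun p => F' p.1).
by exists (fun p => F p.2).
Qed.

Lemma Rec_and L L' : Rec L -> Rec L' -> Rec (fun x => L x /\ L' x).
Proof.
move=> HL HL'; have [|M [mul [h [Hh [F HF]]]]] := @Rec_family bool (fun b => if b then L else L').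
  by case.
exists M, mul, h; split=> //; exists (fun m => F true m /\ F false m) => x.
by rewrite -(HF true) -(HF false).
Qed.

Lemma Rec_or L L' : Rec L -> Rec L' -> Rec (fun x => L x \/ L' x).
Proof.
move=> HL HL'; have [|M [mul [h [Hh [F HF]]]]] := @Rec_family bool (fun b => if b then L else L').
  by case.
exists M, mul, h; split=> //; exists (fun m => F true m \/ F false m) => x.
by rewrite -(HF true) -(HF false).
Qed.

Lemma Rec_has (p : pred S) : Rec (has p).
Proof.
exists bool, orb, (has p); split; first by move=> x y; rewrite has_cat.
by exists is_true.
Qed.

Lemma Rec_count1 (p : pred S) : Rec (fun x => count p x = 1).
Proof.
(* Counting up to two: the components say whether there is at least one occurrence and whether there
   are at least two. *)
exists (bool * bool)%type, (fun m n => (m.1 || n.1, [|| m.2, n.2 | m.1 && n.1])),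
  (fun x => (0 < count p x, 1 < count p x)); split.
  by move=> x y; rewrite count_cat /=; case: (count p x) (count p y) => [|[|?]] [|[|?]].
exists (fun m => m = (true, false)) => x; by case: (count p x) => [|[|?]].
Qed.

(** The value of a factor tells whether it is empty, whether its first letter satisfies [q], whether
    its last letter satisfies [p], and whether a suitable pair occurs inside. A concatenation can
    create a new pair only at the seam. *)
Lemma Rec_succ (p q : pred S) :
  Rec (fun x => exists i a b, [/\ onth x i = Some a, onth x i.+1 = Some b, p a & q b]).
Proof.
pose hd x := if x is b :: _ then q b else false.
pose fix la x := if x is a :: x' then if x' is [::] then p a else la x' else false.
pose fix fd x := if x is a :: x' then (p a && hd x') || fd x' else false.
exists (bool * bool * bool * bool)%type,
  (fun m n => ([&& m.1.1.1 & n.1.1.1], if m.1.1.1 then n.1.1.2 else m.1.1.2,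
     if n.1.1.1 then m.1.2 else n.1.2, [|| m.2, n.2 | m.1.2 && n.1.1.2])),
  (fun x => (nilp x, hd x, la x, fd x)); split.
  move=> x y; congr (_, _, _, _) => /=.
  - by case: x.
  - by case: x.
  - elim: x => [|a x IH] /=; first by case: y.
    by case: x IH => //=; case: y.
  - elim: x => [|a x IH] /=; first by case: (fd y).
    rewrite IH; case: x {IH} => [|b x] /=; first by case: (p a) (hd y) (fd y) => -[] [].
    by rewrite !orbA.
exists (fun m : bool * bool * bool * bool => m.2 = true) => x /=; elim: x => [|a x IH] /=.
  by split=> // -[i [b [c []]]].
split=> [[[|i] [b [c [H1 H2 H3 H4]]]]|/orP[/andP[H1 H2]|/IH[i [b [c H]]]]].
- by case: H1 => ->; case: x H2 {IH} => //= d x [->]; rewrite H3 H4.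
- by apply/orP; right; apply/IH; exists i, b, c.
- by case: x H2 {IH} => //= b x H2; exists 0, a, b.
- by exists i.+1, b, c.
Qed.

Lemma Rec_rquotient L s : Rec L -> Rec (fun x => L (x ++ s)).
Proof.
move=> [M [mul [h [Hh [F HF]]]]]; exists M, mul, h; split=> //.
by exists (fun m => F (mul m (h s))) => x; rewrite HF Hh.
Qed.

End Recognizable.

Section Relabelings.
Variables (S T : Type).

Lemma Rec_map (f : S -> T) L : Rec L -> Rec (fun x => L (map f x)).
Proof.
move=> [M [mul [h [Hh [F HF]]]]]; exists M, mul, (h \o map f); split; last by exists F => x.
by move=> x y; rewrite /= map_cat Hh.
Qed.

(** The powerset construction: the value of [x] is the set of values of all words related to [x]. It
    is multiplicative because words related to [x ++ y] split at the same place. *)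
Lemma Rec_project (R : S -> T -> Prop) L : Rec L ->
  Rec (fun x => exists2 y, List.Forall2 R x y & L y).
Proof.
move=> [M [mul [h [Hh [F HF]]]]].
exists {set M}, (fun X Y : {set M} => [set mul a b | a in X, b in Y]),
  (fun x => [set m | `[< exists2 y, List.Forall2 R x y & h y = m >]]); split.
  move=> x y; apply/setP => m; rewrite inE; apply/asboolP/imset2P.
    move=> [z /List.Forall2_app_inv_l[z1 [z2 [H1 [H2 ->]]]] <-].
    exists (h z1) (h z2); last exact: Hh.
      by rewrite inE; apply/asboolP; exists z1.
    by rewrite inE; apply/asboolP; exists z2.
  move=> [a b]; rewrite !inE => /asboolP[z1 H1 <-] /asboolP[z2 H2 <-] ->.
  by exists (z1 ++ z2); [exact: List.Forall2_app|exact: Hh].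
exists (fun X : {set M} => exists2 m, m \in X & F m) => x; split.
  by move=> [y Hy /HF Ly]; exists (h y) => //; rewrite inE; apply/asboolP; exists y.
by move=> [m]; rewrite inE => /asboolP[y Hy <-] Fm; exists y => //; apply/HF.
Qed.
End Relabelings.

Lemma Forall2_map (I S T : Type) (R : S -> T -> Prop) (f : I -> S) (g : I -> T) s :
  (forall i, R (f i) (g i)) -> List.Forall2 R (map f s) (map g s).
Proof. by move=> H; elim: s => [|i s IH] /=; constructor. Qed.

Lemma Forall2_mapl (I : eqType) (S T : Type) (d : T) (R : S -> T -> Prop) (f : I -> S) s y :
  uniq s -> List.Forall2 R (map f s) y ->
  exists2 g, y = map g s & {in s, forall i, R (f i) (g i)}.
Proof.
elim: s y => [|i s IH] y /=; first by move=> _ H; inversion H; exists (fun _ => d).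
move=> /andP[is_ us] H; inversion H as [|a b x z Hab Hxz]; subst.
have [g -> Hg] := IH _ us Hxz; exists (fun j => if j == i then b else g j).
  rewrite eqxx; congr cons; apply/eq_in_map => j js.
  by case: eqP => // ji; move: is_; rewrite -ji js.
move=> j; rewrite inE; case: eqP => [-> _ //|_ /=]; exact: Hg.
Qed.

Lemma onth_map_ord (T : Type) n (g : 'I_n -> T) i b :
  onth (map g (enum 'I_n)) i = Some b <-> exists2 j : 'I_n, i = j & g j = b.
Proof.
have Hn (j : 'I_n) : onth (map g (enum 'I_n)) j = Some (g j).
  by rewrite onth_map onthE (nth_map j) ?size_enum_ord // nth_ord_enum.
split=> [H|[j -> <-]]; last exact: Hn.
have Hi : i < n by have := onthTE (map g (enum 'I_n)) i; rewrite H size_map size_enum_ord.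
by exists (Ordinal Hi) => //; move: (Hn (Ordinal Hi)); rewrite H => -[].
Qed.

(** * Evaluating formulas by finite multiplications *)

Section Buchi.
Variable A : Type.

(** The label of the edge leaving the node ([None] at the last one), followed by the node variables
    placed there and the set variables containing it. Since all variables are recorded, one alphabet
    serves every formula. *)
Definition letter := (option A * (nat -> Prop) * (nat -> Prop))%type.

Definition encode_at (w : seq A) (nu : nat -> option 'I_(size w).+1) (mu : nat -> 'I_(size w).+1 -> Prop)
    (i : 'I_(size w).+1) : letter :=
  (onth w i, (fun x => nu x = Some i), (fun X => mu X i)).

Definition encode (w : seq A) nu mu : seq letter := map (@encode_at w nu mu) (enum 'I_(size w).+1).

Lemma has_encode w nu mu p : has p (@encode w nu mu) <-> exists i, p (encode_at nu mu i).
Proof.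
rewrite /encode has_map; split=> [/hasP[i _ Hi]|[i Hi]]; first by exists i.
by apply/hasP; exists i; rewrite ?mem_enum.
Qed.

(** Connectives follow from closure properties. A quantifier guesses the marks of its variable anew,
    which is a projection; for a node variable the guess must mark exactly one node. *)
Theorem mso_recognizable (f : mso unit A) :
  exists2 L, Rec L & forall w nu mu, sat (g := ed w) nu mu f <-> L (encode nu mu).
Proof.
elim: f => [s x|a x y|x y|x X|f [L RL HL]|f1 [L1 RL1 HL1] f2 [L2 RL2 HL2]
    |f1 [L1 RL1 HL1] f2 [L2 RL2 HL2]|x f [L RL HL]|X f [L RL HL]] /=.
- exists (has (fun l : letter => `[< l.1.2 x >])); first exact: Rec_has.
  move=> w nu mu; rewrite has_encode; split=> [[v [H _]]|[v /asboolP H]].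
    by exists v; apply/asboolP.
  by exists v; split=> //; case: s.
- exists (fun z => exists i b c, [/\ onth z i = Some b, onth z i.+1 = Some c,
     `[< b.1.1 = Some a /\ b.1.2 x >] & `[< c.1.2 y >]]); first exact: Rec_succ.
  move=> w nu mu; split=> [[u [v [H1 [H2 [H3 H4]]]]]|[i [b [c []]]]].
    exists u, (encode_at nu mu u), (encode_at nu mu v); split.
    + by apply/onth_map_ord; exists u.
    + by apply/onth_map_ord; exists v.
    + by apply/asboolP.
    + by apply/asboolP.
  move=> /onth_map_ord[u -> <-] /onth_map_ord[v Hv <-] /asboolP[H1 H2] /asboolP H3.
  by exists u, v.
- exists (has (fun l : letter => `[< l.1.2 x /\ l.1.2 y >])); first exact: Rec_has.
  move=> w nu mu; rewrite has_encode; split=> [[v H]|[v /asboolP H]]; last by exists v.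
  by exists v; apply/asboolP.
- exists (has (fun l : letter => `[< l.1.2 x /\ l.2 X >])); first exact: Rec_has.
  move=> w nu mu; rewrite has_encode; split=> [[v H]|[v /asboolP H]]; last by exists v.
  by exists v; apply/asboolP.
- by exists (fun z => ~ L z); [exact: Rec_not|move=> w nu mu; rewrite HL].
- by exists (fun z => L1 z /\ L2 z); [exact: Rec_and|move=> w nu mu; rewrite HL1 HL2].
- by exists (fun z => L1 z \/ L2 z); [exact: Rec_or|move=> w nu mu; rewrite HL1 HL2].
- pose R (a b : letter) := [/\ a.1.1 = b.1.1, forall y, y != x -> a.1.2 y = b.1.2 y & a.2 = b.2].
  pose p (l : letter) := `[< l.1.2 x >].
  exists (fun z => exists2 y, List.Forall2 R z y & L y /\ count p y = 1).
    by apply: Rec_project; apply: Rec_and => //; exact: Rec_count1.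
  move=> w nu mu; split=> [[v Hv]|[y Hy [Ly py]]].
    exists (encode (upd nu x (Some v)) mu).
      by apply: Forall2_map => i; split=> //= y1 yx; rewrite upd_neq.
    split; first exact/HL.
    rewrite /encode count_map -size_filter.
    rewrite (eq_filter (a2 := pred1 v)) ?filter_pred1_uniq ?enum_uniq ?mem_enum // => i /=.
    rewrite /p /= upd_eq; apply/asboolP/eqP => [[->]//|->//].
  have d : letter := (None, fun _ => False, fun _ => False).
  have [g Hg HR] := Forall2_mapl d (enum_uniq _) Hy.
  have {}HR i : R (encode_at nu mu i) (g i) by apply: HR; rewrite mem_enum.
  (* The guessed letters mark [x] exactly once; the node so marked is the witness. *)
  move: py; rewrite Hg count_map -size_filter.
  case E: [seq _ <- _ | _] => [|v [|? ?]] // _.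
  have Hv i : p (g i) <-> i = v.
    have := mem_filter (preim g p) i (enum 'I_(size w).+1); rewrite E inE mem_enum andbT /= => <-.
    by split=> [/eqP|->].
  exists v; apply/HL; move: Ly; congr (L _); rewrite Hg; apply: eq_map => i.
  have [H1 H2 H3] := HR i; rewrite [LHS]surjective_pairing -H3; congr pair.
  rewrite [LHS]surjective_pairing -H1; congr pair; apply: funext => y1; rewrite /upd; case: eqP.
    move=> ->; apply: propext; split=> [/(@asboolP)/Hv->//|[vi]].
    by apply/asboolP/Hv.
  by move=> /eqP/H2.
- pose R (a b : letter) := [/\ a.1.1 = b.1.1, a.1.2 = b.1.2 & forall y, y != X -> a.2 y = b.2 y].
  exists (fun z => exists2 y, List.Forall2 R z y & L y); first exact: Rec_project.
  move=> w nu mu; split=> [[P HP]|[y Hy Ly]].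
    exists (encode nu (upd mu X P)); last exact/HL.
    by apply: Forall2_map => i; split=> //= y yX; rewrite upd_neq.
  have d : letter := (None, fun _ => False, fun _ => False).
  have [g Hg HR] := Forall2_mapl d (enum_uniq _) Hy.
  have {}HR i : R (encode_at nu mu i) (g i) by apply: HR; rewrite mem_enum.
  exists (fun i => (g i).2 X); apply/HL; move: Ly; congr (L _); rewrite Hg; apply: eq_map => i.
  have [H1 H2 H3] := HR i; rewrite [LHS]surjective_pairing; congr pair.
    by rewrite [LHS]surjective_pairing -H1 -H2.
  apply: funext => Y; rewrite /upd; case: eqP => [->//|/eqP/H3 <-//].
Qed.

End Buchi.

(** * Uniformization *)

Section LexMin.
Variables (T : Type) (r : T -> nat) (N : nat).
Hypothesis r_inj : injective r.
Hypothesis r_lt : forall x, r x < N.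
Variable V : (T -> Prop) -> Prop.

(** At the first element where the two sets differ, [t] contains it: being least means taking early
    elements whenever possible. *)
Definition beats (t s : T -> Prop) :=
  exists x, t x /\ ~ s x /\ forall y, r y < r x -> (t y <-> s y).

(** Induction on [j] produces a set that is not beaten at any rank below [j]. If it is beaten at
    rank [j], the winner agrees with it at all smaller ranks, so it stays unbeaten there and
    replaces it. *)
Lemma lex_min_exists s : V s -> exists s', V s' /\ forall t, V t -> ~ beats t s'.
Proof.
move=> Vs; suff H j : exists s', V s' /\ forall t x, V t -> r x < j -> t x -> ~ s' x ->
    ~ forall y, r y < r x -> (t y <-> s' y).
  have [s' [Vs' Hs']] := H N; exists s'; split=> // t Vt [x [tx [sx Hx]]].
  exact: (Hs' t x).
elim: j => [|j [s' [Vs' IH]]]; first by exists s.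
case: (EM (exists t x, [/\ V t, r x = j, t x, ~ s' x & forall y, r y < r x -> (t y <-> s' y)])).
- move=> [t [x [Vt xj tx sx Hx]]]; exists t; split=> // t' x' Vt'.
  rewrite ltnS leq_eqVlt => /orP[/eqP|] x'j tx' ntx' H.
    by apply: ntx'; rewrite (r_inj (etrans x'j (esym xj))).
  have x'x : r x' < r x by rewrite xj.
  apply: (IH t' x' Vt' x'j tx'); first by rewrite -(Hx x').
  by move=> y yx'; rewrite (H y yx') (Hx y) // (ltn_trans yx').
- move=> H; exists s'; split=> // t x Vt; rewrite ltnS leq_eqVlt => /orP[/eqP|] xj tx sx Hx.
    by apply: H; exists t, x.
  exact: (IH t x).
Qed.

Lemma lex_min_unique s s' : V s -> V s' -> (forall t, V t -> ~ beats t s) ->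
  (forall t, V t -> ~ beats t s') -> s = s'.
Proof.
move=> Vs Vs' Hs Hs'; apply: funext => x; apply: propext.
move: {2}(r x).+1 (ltnSn (r x)) => n; elim: n x => // n IH x; rewrite ltnS => Hx.
have H y : r y < r x -> (s y <-> s' y) by move=> yx; apply: IH; apply: leq_trans Hx.
case: (EM (s x)) (EM (s' x)) => sx [] s'x; split=> // _; exfalso.
  by apply: (Hs' s) => //; exists x.
by apply: (Hs s') => //; exists x; do 2!split=> //; move=> y yx; split=> ?; apply/(H y yx).
Qed.
End LexMin.

(** * The order of positions is definable *)

Section PositionOrder.
Variable A : finType.

Lemma ed_leP (w : seq A) (u v : gV (ed w)) : (u : nat) <= v <->
  forall Z : unit -> gV (ed w) -> Prop, Z tt u ->
    (forall x, forall a, forall y, Z tt x -> gE (ed w) x a y -> Z tt y) -> Z tt v.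
Proof.
split=> [uv Z Zu HZ|H].
- case: v uv => v; elim: v => [|v IH] Hv.
    rewrite leqn0 => /eqP u0; rewrite (_ : Ordinal Hv = u) //; exact: ord_inj.
  rewrite leq_eqVlt => /orP[/eqP uv|uv].
    by rewrite (_ : Ordinal Hv = u) //; apply: ord_inj.
  have [a Ha] : exists a, onth w v = Some a.
    by move: (Hv); rewrite ltnS -onthTE; case: onth => // a _; exists a.
  by apply: (HZ (Ordinal (ltnW Hv)) a) => //; exact: IH.
- apply: (H (fun _ (x : gV (ed w)) => is_true ((u : 'I_(size w).+1) <= (x : 'I_(size w).+1)))) => // x a y ux [-> _].
  exact: leqW.
Qed.

Lemma Def2_lt : @Def2 _ _ (@ed A) (fun w u v => (u : nat) < v).
Proof.
apply: (@Def_ext _ _ _ _ (fun w (e : env (extN (extN (c0 (@ed A)))) w) => e.1.2 <> e.2 /\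
  forall Z : unit -> gV (ed w) -> Prop, Z tt e.1.2 ->
    (forall x : gV (ed w), forall a, forall y : gV (ed w), Z tt x -> gE (ed w) x a y -> Z tt y) -> Z tt e.2)).
  move=> w e; rewrite -(ed_leP e.1.2 e.2) ltn_neqAle; split=> [[H1 H2]|/andP[H1 H2]].
    by apply/andP; split=> //; apply/eqP => H; apply: H1; exact: ord_inj.
  by split=> // H; rewrite H eqxx in H1.
repeat def1.
Qed.
End PositionOrder.

Section DefUse.
Variables (A K : Type) (Gr : K -> graph unit A) (c : ctx Gr).

Lemma Def0_use P : Def0 Gr P -> @Def _ _ _ c (fun k e => P k).
Proof. exact: (@Def0_reindex _ _ Gr K id c). Qed.

Lemma Def1_use P t : Def1 P -> Acc t -> @Def _ _ _ c (fun k e => P k (t k e)).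
Proof. exact: (@Def1_reindex _ _ Gr K id c). Qed.

Lemma Def2_use P t t' : Def2 P -> Acc t -> Acc t' -> @Def _ _ _ c (fun k e => P k (t k e) (t' k e)).
Proof. exact: (@Def2_reindex _ _ Gr K id c). Qed.
End DefUse.

Section Uniformization.
Variables (A K I : finType).
Variables (E : forall w : seq A, gV (ed w) * K -> I -> gV (ed w) * K -> Prop).
Variables (Init Fin : forall w : seq A, gV (ed w) * K -> Prop).
Hypothesis E_def : forall k i k', @Def2 _ _ (@ed A) (fun w u v => E (u, k) i (v, k')).
Hypothesis Init_def : forall k, @Def1 _ _ (@ed A) (fun w u => @Init w (u, k)).
Hypothesis Fin_def : forall k, @Def1 _ _ (@ed A) (fun w u => @Fin w (u, k)).
Hypothesis E_det : forall w (x y y' : gV (ed w) * K) i, E x i y -> E x i y' -> y = y'.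
Hypothesis Init_unique : forall w (x y : gV (ed w) * K), Init x -> Init y -> x = y.

Local Notation strat w := (K * I -> Finite.sort (gV (ed w)) -> Prop).

Section OneWord.
Variable w : seq A.
Implicit Types s t : strat w.

(** [s (k, i)] is the set of positions where instruction [i] is chosen in state [k]. No step leaves
    a final vertex, so the path of a strategy stops at the first one and ends stuck, as [det_path]
    demands. *)
Definition sstep s (x : gV (ed w) * K) i y := s (x.2, i) x.1 /\ E x i y /\ ~ Fin x.

(** The closed set of vertices is given by one node set for each state, which keeps reachability
    between vertices monadic over nodes. *)
Definition sreach s (x y : gV (ed w) * K) := forall Z : K -> gV (ed w) -> Prop, Z x.2 x.1 ->
  (forall k, forall u : gV (ed w), forall i, forall k', forall v : gV (ed w),
     Z k u -> s (k, i) u /\ E (u, k) i (v, k') /\ ~ Fin (u, k) -> Z k' v) -> Z y.2 y.1.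

Lemma sreachP s x y : sreach s x y <-> exists z, walk (sstep s) x z y.
Proof.
rewrite reachP; split=> H Z Zx HZ.
- have := H (fun k u => Z (u, k)); rewrite -!surjective_pairing; apply=> //.
  by move=> k u i k' v Zu Hs; apply: HZ Zu Hs.
- by apply: (H (fun x => Z x.2 x.1)) => // -[u k] i [v k'] /= Zu Hs; apply: HZ Zu Hs.
Qed.

Definition valid s :=
  (forall k, forall u : gV (ed w), forall i, forall j, s (k, i) u -> s (k, j) u -> i = j) /\
  exists k, exists u : gV (ed w), exists k', exists v : gV (ed w),
    Init (u, k) /\ Fin (v, k') /\ sreach s (u, k) (v, k').

(** The order compares the pair (state, instruction) first and the position second. The first
    comparison is between elements of a finite type and is settled when the formula is written; the
    second is definable. [sbeatsE] identifies this with [beats] for the rank [rk]. *)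
Definition sbeats t s := exists k, exists i, exists u : gV (ed w), t (k, i) u /\ ~ s (k, i) u /\
  forall k', forall i', forall v : gV (ed w),
    (enum_rank (k', i') < enum_rank (k, i) \/ (k', i') = (k, i) /\ (v : 'I_(size w).+1) < (u : 'I_(size w).+1)) ->
    (t (k', i') v <-> s (k', i') v).

Definition best s := valid s /\ forall t : strat w, valid t -> ~ sbeats t s.

Let rk (x : K * I * gV (ed w)) : nat := enum_rank x.1 * (size w).+1 + (x.2 : 'I_(size w).+1).

Lemma rk_ltP k u k' (u' : gV (ed w)) : rk (k', u') < rk (k, u) <->
  enum_rank k' < enum_rank k \/ k' = k /\ (u' : 'I_(size w).+1) < (u : 'I_(size w).+1).
Proof.
have H a b c (d : 'I_(size w).+1) : a < b -> a * (size w).+1 + d < b * (size w).+1 + c.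
  move=> ab; apply: leq_trans (leq_addr _ _); apply: leq_trans (leq_mul ab (leqnn _)).
  by rewrite mulSn addnC ltn_add2r.
rewrite /rk /=; split=> [Hr|[/H->//|[-> Hu]]]; last by rewrite ltn_add2l.
case: (ltngtP (enum_rank k') (enum_rank k)) => Hk; [by left| |].
  by move: (ltn_trans Hr (H _ _ u' u Hk)); rewrite ltnn.
move/ord_inj/enum_rank_inj: Hk => Hk; right; split=> //.
by move: Hr; rewrite Hk ltn_add2l.
Qed.

Let rk_inj : injective rk.
Proof.
move=> [k u] [k' u'] H; have := rk_ltP k u k' u'; have := rk_ltP k' u' k u; rewrite H ltnn.
move=> H1 H2; have Hk : k = k'.
  apply/enum_rank_inj/ord_inj; case: (ltngtP (enum_rank k) (enum_rank k')) => // Hk.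
    by have := H1.2 (or_introl Hk).
  by have := H2.2 (or_introl Hk).
rewrite -Hk in H1 H2 *; congr (_, _); apply: ord_inj; case: (ltngtP u u') => // Hu.
  by have := H1.2 (or_intror (conj erefl Hu)).
by have := H2.2 (or_intror (conj erefl Hu)).
Qed.

Let rk_lt x : rk x < #|{: K * I}| * (size w).+1.
Proof.
case: x => k u; rewrite /rk /=; apply: (@leq_trans ((enum_rank k).+1 * (size w).+1)).
  by rewrite mulSn addnC ltn_add2r.
by rewrite leq_mul2r ltn_ord orbT.
Qed.

Let V (S : K * I * gV (ed w) -> Prop) := valid (fun k u => S (k, u)).

Lemma sbeatsE t s : sbeats t s <-> beats rk (fun x => t x.1 x.2) (fun x => s x.1 x.2).
Proof.
split=> [[k [i [u [H1 [H2 H]]]]]|[[[k i] u] [H1 [H2 H]]]].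
  exists (k, i, u); do 2!split=> //; move=> -[[k' i'] v] /rk_ltP; exact: H.
by exists k, i, u; do 2!split=> //; move=> k' i' v Hr; apply: (H (k', i', v)); apply/rk_ltP.
Qed.

Lemma best_exists s : valid s -> exists s', best s'.
Proof.
move=> Vs; have [|S [VS HS]] := @lex_min_exists _ _ _ rk_inj rk_lt V (fun x => s x.1 x.2).
  exact: Vs.
exists (fun k u => S (k, u)); split=> // t Vt /sbeatsE Hb.
apply: (HS (fun x => t x.1 x.2)) => //; move: Hb; congr (beats rk _ _).
by apply: funext => -[].
Qed.

Lemma best_unique s s' : best s -> best s' -> s = s'.
Proof.
move=> [Vs Hs] [Vs' Hs']; have H (S : K * I * gV (ed w) -> Prop) : V S -> valid (fun k u => S (k, u)) by [].
have He (t : K * I * gV (ed w) -> Prop) : (fun x => t (x.1, x.2)) = t by apply: funext => -[].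
suff Hx : (fun x => s x.1 x.2) = (fun x => s' x.1 x.2).
  by apply: funext => k; apply: funext => u; have := congr1 (@^~ (k, u)) Hx.
apply: (@lex_min_unique _ rk V) => // t Vt.
  by have /sbeatsE := Hs _ (H _ Vt); rewrite /= He.
by have /sbeatsE := Hs' _ (H _ Vt); rewrite /= He.
Qed.

Lemma sstep_det s : valid s -> forall x i y j z, sstep s x i y -> sstep s x j z -> i = j /\ y = z.
Proof.
move=> [Hs _] x i y j z [H1 [H2 _]] [H1' [H2' _]].
have ij := Hs _ _ _ _ H1 H1'; rewrite -ij in H2' *; split=> //; exact: E_det H2 H2'.
Qed.

(* At each vertex the strategy picks an instruction that decreases the distance to a final vertex. *)
Lemma valid_exists x y l : Init x -> Fin l -> walk (@E w) x y l -> exists s, valid s.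
Proof.
move=> Ix Fl Hw.
(* [co n x] states that some walk of length [n] leads from [x] to a final vertex. A good instruction
   leads to a vertex with such a walk shorter than all those from [x]; picking a single one makes
   the strategy functional. *)
pose co n x := exists z l, [/\ size z = n, Fin l & walk (@E w) x z l].
pose good (x : gV (ed w) * K) i := exists n y, [/\ E x i y, co n y & forall m, co m x -> n < m].
pose s : strat w := fun k u => [pick i | `[< good (u, k.1) i >]] = Some k.2.
suff H n z m : m <= n -> co m z -> exists l' p, Fin l' /\ walk (sstep s) z p l'.
  have [|l' [p [Fl' Hp]]] := H (size y) x (size y) (leqnn _); first by exists y, l.
  exists s; split=> [k u i j|]; first by rewrite /s /= => -> [].
  exists x.2, x.1, l'.2, l'.1; rewrite -!surjective_pairing; do 2!split=> //.
  by apply/sreachP; exists p.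
elim: n z m => [|n IH] z m Hm Hz.
  move: Hm Hz; rewrite leqn0 => /eqP-> [[|b z'] [l' [// _ Fl' zl']]].
  by exists l', [::]; split.
case: (EM (Fin z)) => Fz; first by exists z, [::]; split.
have Hex : exists d, `[< co d z >] by exists m; apply/asboolP.
case: (ex_minnP Hex) => d /= /asboolP Hd0 Hmin; case: Hd0 => zd [l' [Hd Fl' Hzd]].
have {}Hmin k : co k z -> d <= k by move=> /asboolP; exact: Hmin.
case: zd Hd Hzd => [_ zl'|i zd Hd [y' Hi Hzd]]; first by rewrite zl' in Fz.
have Hgood : good z i.
  exists (size zd), y'; split=> //; first by exists zd, l'.
  by move=> k /Hmin; rewrite -Hd.
case E0 : [pick i | `[< good z i >]] => [i0|]; last first.
  by move: E0; case: pickP => // H0 _; move: (H0 i); rewrite (introT (asboolP _) Hgood).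
have [n0 [y0 [Hy0 Hn0 Hlt]]] : good z i0.
  by move: E0; case: pickP => // j /asboolP Hj [<-].
have [|l0 [p [Fl0 Hp]]] := IH y0 n0 _ Hn0.
  by rewrite -ltnS; apply: leq_trans Hm; exact: Hlt.
by exists l0, (i0 :: p); split=> //; exists y0 => //; split=> //; rewrite /s /= -surjective_pairing.
Qed.

End OneWord.

Section VertexPredicates.
Variable c : ctx (@ed A).

Lemma Def_E t t' k i k' : Acc t -> Acc t' ->
  @Def _ _ _ c (fun w e => E (t w e, k) i (t' w e, k')).
Proof. exact: Def2_use (E_def k i k'). Qed.

Lemma Def_Init t k : Acc t -> @Def _ _ _ c (fun w e => Init (t w e, k)).
Proof. exact: Def1_use (Init_def k). Qed.

Lemma Def_Fin t k : Acc t -> @Def _ _ _ c (fun w e => Fin (t w e, k)).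
Proof. exact: Def1_use (Fin_def k). Qed.

End VertexPredicates.

Ltac def2 := first [eapply Def_E; acc | eapply Def_Init; acc | eapply Def_Fin; acc | def1].

Section StrategySteps.
Variable c : ctx (@ed A).
Variable s : forall w, env c w -> strat w.
Hypothesis s_acc : forall k, SAcc (fun w e => s e k).

Lemma Def_sstep t t' k i k' : Acc t -> Acc t' ->
  @Def _ _ _ c (fun w e => sstep (s e) (t w e, k) i (t' w e, k')).
Proof. move=> Ht Ht'; rewrite /sstep; cbn [fst snd]; repeat def2. Qed.

Lemma Def_sreach t t' k k' : Acc t -> Acc t' ->
  @Def _ _ _ c (fun w e => sreach (s e) (t w e, k) (t' w e, k')).
Proof. move=> Ht Ht'; rewrite /sreach; cbn [fst snd]; repeat def2. Qed.

End StrategySteps.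

Ltac def3 := lazymatch goal with
  | |- @Def _ _ _ ?c (fun w e => sreach (@?s w e) (@?t w e, ?k) (@?t' w e, ?k')) =>
      refine (@Def_sreach c s _ t t' k k' _ _); [intro; sacc|acc|acc]
  | |- @Def _ _ _ ?c (fun w e => sstep (@?s w e) (@?t w e, ?k) ?i (@?t' w e, ?k')) =>
      refine (@Def_sstep c s _ t t' k i k' _ _); [intro; sacc|acc|acc]
  | |- @Def _ _ _ _ (fun w e => is_true _) =>
      first [exact: Def_const | eapply (Def2_use (Def2_lt A)); acc]
  | |- _ => def2
  end.

Lemma Def_valid (c : ctx (@ed A)) (s : forall w, env c w -> strat w) :
  (forall k, SAcc (fun w e => s w e k)) ->
  @Def _ _ (@ed A) c (fun w e => valid (s w e)).
Proof. move=> Hs; rewrite /valid; repeat def3. Qed.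

Lemma Def_sbeats (c : ctx (@ed A)) (s t : forall w, env c w -> strat w) :
  (forall k, SAcc (fun w e => s w e k)) -> (forall k, SAcc (fun w e => t w e k)) ->
  @Def _ _ (@ed A) c (fun w e => sbeats (t w e) (s w e)).
Proof.
move=> Hs Ht; rewrite /sbeats; repeat def3.
Qed.

Lemma Def_best (c : ctx (@ed A)) (s : forall w, env c w -> strat w) :
  (forall k, SAcc (fun w e => s w e k)) ->
  @Def _ _ (@ed A) c (fun w e => best (s w e)).
Proof.
move=> Hs; apply: Def_and; first exact: Def_valid.
def1; def1; first by apply: (@Def_valid (extF c _) (fun w e => e.2)) => k; sacc.
def1; apply: (@Def_sbeats (extF c _) (fun w e => s w e.1) (fun w e => e.2)) => k; sacc.
Qed.

Definition chosen : transduction A I := fun w y =>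
  exists s : strat w, best s /\ exists x l, [/\ Init x, Fin l & walk (sstep s) x y l].

Lemma best_final_stuck w (s : strat w) l : Fin l -> forall i x, ~ sstep s l i x.
Proof. by move=> Fl i x [_ [_ []]]. Qed.

Lemma chosen_functional : functional chosen.
Proof.
move=> w y y' [s [Bs [x [l [Ix Fl Hw]]]]] [s' [Bs' [x' [l' [Ix' Fl' Hw']]]]].
move: Hw'; rewrite -(best_unique Bs Bs') -(Init_unique Ix Ix').
exact: (walk_stuck_unique (sstep_det Bs.1) (best_final_stuck Fl) (best_final_stuck Fl') Hw).
Qed.

Lemma chosen_sound w y : chosen w y -> exists x l, [/\ Init x, Fin l & walk (@E w) x y l].
Proof.
move=> [s [_ [x [l [Ix Fl Hw]]]]]; exists x, l; split=> //.
by elim: y x {Ix} Hw => [//|i y IH] x /= [x' [_ [H _]] /IH]; exists x'.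
Qed.

Lemma chosen_exists w (s : strat w) : valid s -> exists y, chosen w y.
Proof.
move=> /best_exists[s' Bs']; have [[_ [k [u [k' [v [Iu [Fv /sreachP[y Hy]]]]]]]] _] := Bs'.
by exists y, s'; split=> //; exists (u, k), (v, k').
Qed.

Lemma chosen_total w x y l : Init x -> Fin l -> walk (@E w) x y l -> exists y', chosen w y'.
Proof. by move=> Ix Fl /(valid_exists Ix Fl)[s Vs]; exact: chosen_exists Vs. Qed.

(** The copies are the states. Output nodes are the vertices reached under the best strategy, output
    edges are its steps; as this path is deterministic and ends stuck, it is a copy of [ed y]. *)
Lemma chosen_mso : string_mso chosen.
Proof.
split; first exact: chosen_functional.
exists K, (fun k w u => exists s : strat w, best s /\ exists k0, exists u0 : gV (ed w),
    Init (u0, k0) /\ sreach s (u0, k0) (u, k)),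
  (fun k k' i w u v => exists s : strat w, best s /\ sstep s (u, k) i (v, k')); split.
- apply: (@Def_ext _ _ _ _ (fun w e => exists s : strat w, valid s)) => [w e|].
    by split=> [[s /chosen_exists]//|[y [s [[Vs _] _]]]]; exists s.
  by def1; apply: (@Def_valid (extF (c0 _) _) (fun w e => e.2)) => k; sacc.
- move=> k; rewrite /Def1; def1; apply: Def_and; last by repeat def3.
  by apply: (@Def_best (extF (extN (c0 _)) _) (fun w e => e.2)) => j; sacc.
- move=> k k' i; rewrite /Def2; def1; apply: Def_and; last by repeat def3.
  by apply: (@Def_best (extF (extN (extN (c0 _))) _) (fun w e => e.2)) => j; sacc.
- move=> w y [s [Bs [x [l [Ix Fl Hw]]]]].
  have [f [fi f0 fl fr fe]] := det_path (sstep_det Bs.1) (best_final_stuck Fl) Hw.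
  exists f; split=> //.
  + move=> [u k] /=; rewrite -fr -sreachP; split=> [[s' [Bs' [k0 [u0 [I0 H]]]]]|H].
      by move: H; rewrite -(best_unique Bs Bs') (Init_unique I0 Ix).
    by exists s; split=> //; exists x.2, x.1; rewrite -surjective_pairing.
  + move=> v b v'; split=> [/fe H|[s' [Bs' H]]].
      by exists s; rewrite -!surjective_pairing.
    by apply/fe; move: H; rewrite (best_unique Bs Bs') -!surjective_pairing.
Qed.

End Uniformization.

(** * Homomorphisms are MSO definable *)

Section Homomorphism.
Variables (I B : finType) (phi : I -> seq B).

Lemma ed_out (w : seq I) (u : gV (ed w)) i :
  (exists v, gE (ed w) u i v) <-> onth w (u : 'I_(size w).+1) = Some i.
Proof.
split=> [[v []]//|Hi]; have Hu : (u : 'I_(size w).+1) < size w by rewrite -onthTE Hi.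
by exists (Ordinal (Hu : u.+1 < (size w).+1)).
Qed.

(* The last cell is the extra node at the end of the output path. *)
Let cells (w : seq I) := rcons [seq map Some (phi i) | i <- w] [:: None].
Let cell (w : seq I) u := nth [::] (cells w) u.
Let sh (w : seq I) := shape (cells w).
Let N := \max_(i : I) size (phi i).

Let cellE w (u : 'I_(size w).+1) :
  cell w u = if onth w u is Some i then map Some (phi i) else [:: None].
Proof.
rewrite /cell /cells nth_rcons size_map; case: ltngtP => Hu.
- by have := onthTE w u; rewrite Hu onthE; elim: w u Hu => [|i w IH] [[|u] Hu0] //= Hu; apply: (IH (Ordinal (Hu0 : u < (size w).+1))).
- by move: (ltn_ord u); rewrite ltnS leqNgt Hu.
- by rewrite Hu onth_default.
Qed.

(** The successor allows for the last cell, of size 1 even when [N] is 0. *)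
Let size_cell w (u : 'I_(size w).+1) : size (cell w u) <= N.+1.
Proof.
rewrite cellE; case: onth => [i|] //; rewrite size_map; apply: leqW.
exact: (leq_bigmax i).
Qed.

Let out (w : seq I) := flatten (map phi w).

Let flatten_cells w : flatten (cells w) = rcons (map Some (out w)) None.
Proof. by rewrite /cells flatten_rcons map_flatten -map_comp cats1. Qed.

Let sumn_sh w : sumn (sh w) = (size (out w)).+1.
Proof. by rewrite -size_flatten flatten_cells size_rcons size_map. Qed.

(** The entry [None] of the last cell agrees with the value of [onth] past the end, so one equation
    also covers the last node. *)
Let onth_cells w p : onth (out w) p = nth None (cell w (reshape_index (sh w) p)) (reshape_offset (sh w) p).
Proof. by rewrite -nth_flatten flatten_cells nth_rcons_default -onthE. Qed.

(** Copy [j] of node [u] is the output position at offset [j] in the image of the letter leaving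
    [u]. The last input node carries no letter and contributes, as copy 0, the end of the output
    path. *)
Definition hom_node (j : 'I_N.+2) (w : seq I) (u : gV (ed w)) :=
  (exists i, (exists v, gE (ed w) u i v) /\ j < size (phi i)) \/
  (~ (exists i, exists v, gE (ed w) u i v) /\ (j = 0 :> nat)).

Let hom_nodeE j w (u : gV (ed w)) : hom_node j u <-> j < size (cell w (u : 'I_(size w).+1)).
Proof.
rewrite /hom_node cellE; case E : onth => [i|].
  rewrite size_map; split=> [[[i' [/ed_out]]|[[]]]|H].
  - by rewrite E => -[->].
  - by exists i; apply/ed_out.
  - by left; exists i; split=> //; apply/ed_out.
split=> [[[i [/ed_out]]|[_ ->]]|] //; first by rewrite E.
case: j => -[|j] //= Hj _; right; split=> // -[i /ed_out]; by rewrite E.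
Qed.

Definition hom_lex (j j' : 'I_N.+2) (w : seq I) (u u' : gV (ed w)) :=
  (u : 'I_(size w).+1) < (u' : 'I_(size w).+1) \/ u = u' /\ j < j'.

(** Letters with empty image contribute no node, so the next output position may lie arbitrarily far
    to the right; it is described as the lexicographic successor among existing pairs. *)
Definition hom_edge (j j' : 'I_N.+2) b (w : seq I) (u u' : gV (ed w)) :=
  [/\ exists i, (exists v, gE (ed w) u i v) /\ onth (phi i) j = Some b,
      hom_node j' u', hom_lex j j' u u' &
      forall k, forall t : gV (ed w), hom_node k t -> ~ (hom_lex j k u t /\ hom_lex k j' t u')].

Let index_lt w (p : 'I_(size (out w)).+1) : reshape_index (sh w) p < (size w).+1.
Proof.
by have := @reshape_indexP (sh w) p; rewrite sumn_sh => /(_ (ltn_ord p)); rewrite size_map size_rcons size_map.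
Qed.

Let offset_lt w (p : 'I_(size (out w)).+1) : reshape_offset (sh w) p < size (cell w (Ordinal (index_lt p))).
Proof. by have := @reshape_offsetP (sh w) p; rewrite sumn_sh => /(_ (ltn_ord p)); rewrite nth_shape. Qed.

Let vertex w (p : 'I_(size (out w)).+1) : gV (ed w) * 'I_N.+2 :=
  (Ordinal (index_lt p), inord (reshape_offset (sh w) p)).

Let vertex_offset w p : (@vertex w p).2 = reshape_offset (sh w) p :> nat.
Proof. by rewrite inordK // ltnS (leq_trans (ltnW (offset_lt p))) ?size_cell. Qed.

Let vertex_onto w (u : gV (ed w)) j : hom_node j u <-> exists p, @vertex w p = (u, j).
Proof.
rewrite hom_nodeE; split=> [H|[p [<-]]].
  have H' : j < nth 0 (sh w) (u : 'I_(size w).+1) by rewrite nth_shape.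
  have Hp : flatten_index (sh w) (u : 'I_(size w).+1) j < (size (out w)).+1.
    by rewrite -sumn_sh; apply: flatten_indexP.
  exists (Ordinal Hp); rewrite /vertex; congr (_, _).
    by apply: ord_inj; rewrite /= flatten_indexKl.
  by apply: ord_inj; rewrite flatten_indexKr // inordK.
by move=> <-; rewrite (vertex_offset p); exact: offset_lt.
Qed.

Let vertex_lex w (p q : 'I_(size (out w)).+1) :
  hom_lex (vertex p).2 (vertex q).2 (vertex p).1 (vertex q).1 <-> p < q.
Proof.
have Hle := @reshape_leq (sh w) q p; rewrite ltnNge {}Hle /hom_lex !vertex_offset /=.
set a := reshape_index _ q; set b := reshape_index _ p; rewrite negb_or negb_and -leqNgt -ltnNge.
split=> [[ba|[ab H]]|/andP[]].
- by rewrite (ltnW ba) neq_ltn ba orbT.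
- have ab' : b = a by have := congr1 val ab.
  by rewrite ab' leqnn H orbT.
- rewrite leq_eqVlt eq_sym => /orP[/eqP ab|->]; last by left.
  move=> /orP[/eqP[]//|H]; right; split=> //; by apply: ord_inj.
Qed.

Lemma hom_mso : string_mso (fun w z => z = flatten (map phi w)).
Proof.
have Nd (c : ctx (@ed I)) j t : Acc t -> @Def _ _ _ c (fun w e => @hom_node j w (t w e)).
  by move=> Ht; rewrite /hom_node; repeat def1.
have Lx (c : ctx (@ed I)) j j' t t' : Acc t -> Acc t' ->
    @Def _ _ _ c (fun w e => @hom_lex j j' w (t w e) (t' w e)).
  move=> Ht Ht'; apply: Def_or; first exact: (Def2_use (Def2_lt I)).
  apply: Def_and; last exact: Def_const.
  exact: Def_eq.
split; first by move=> w z z' -> ->.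
exists 'I_N.+2, hom_node, hom_edge; split.
- by apply: (Def_ext _ (Def_const _ True)) => w e; split=> // _; exists (out w).
- by move=> j; apply: Nd; acc.
- move=> j j' b; apply: (@Def_ext _ _ _ _ (fun w (e : env (extN (extN (c0 (@ed I)))) w) =>
    (exists i, (exists v, gE (ed w) e.1.2 i v) /\ onth (phi i) j = Some b) /\
    hom_node j' e.2 /\ hom_lex j j' e.1.2 e.2 /\
    forall k, forall t : gV (ed w), hom_node k t -> ~ (hom_lex j k e.1.2 t /\ hom_lex k j' t e.2))).
    by move=> w e; split=> [[? [? []]]|[]].
  apply: Def_and; first by repeat def1.
  apply: Def_and; first by apply: Nd; acc.
  apply: Def_and; first by apply: Lx; acc.
  apply: Def_allfin => k; def1; apply: Def_imp; first by apply: Nd; acc.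
  by apply: Def_not; apply: Def_and; apply: Lx; acc.
- move=> w z ->; exists (@vertex w); split.
  + move=> p q Hpq; apply: ord_inj; case: (ltngtP (nat_of_ord p) (nat_of_ord q)) => // /vertex_lex.
      by rewrite Hpq => -[|[_]]; rewrite ltnn.
    by rewrite Hpq => -[|[_]]; rewrite ltnn.
  + by move=> [u j]; exact: vertex_onto.
  + move=> p b q; have Hlab : (exists i, (exists v, gE (ed w) (vertex p).1 i v) /\
        onth (phi i) (vertex p).2 = Some b) <-> onth (out w) p = Some b.
      rewrite onth_cells -[reshape_index _ _]/(nat_of_ord (Ordinal (index_lt p))) cellE vertex_offset.
      split=> [[i [/ed_out -> <-]]|]; first by rewrite -onthE.
      case E : onth => [i|]; last by case: reshape_offset => [|[]].
      by rewrite -onthE => H; exists i; split=> //; apply/ed_out.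
    split=> [[Hq Hb]|[/Hlab Hb _ /vertex_lex pq Hno]].
      split; first exact/Hlab.
      * by apply/vertex_onto; exists q; rewrite -surjective_pairing.
      * by apply/vertex_lex; rewrite Hq.
      * move=> k t /vertex_onto[r Hr]; have [-> ->] : k = (vertex r).2 /\ t = (vertex r).1 by rewrite Hr.
        by move=> [/vertex_lex H1 /vertex_lex]; rewrite Hq ltnS leqNgt H1.
    (* If [q] were larger than [p + 1], the vertex of [p + 1] would lie strictly between the two. *)
    split=> //; apply/eqP; rewrite eqn_leq pq andbT leqNgt; apply/negP => Hlt.
    have Hr : p.+1 < (size (out w)).+1 by apply: ltn_trans Hlt _.
    apply: (Hno (vertex (Ordinal Hr)).2 (vertex (Ordinal Hr)).1); last by split; apply/vertex_lex => /=.
    by apply/vertex_onto; exists (Ordinal Hr); rewrite -surjective_pairing.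
Qed.
End Homomorphism.

(** * Two-way machines as graphs over the input *)

Section TapePositions.
Variable A : finType.
Implicit Types (w : seq A) (e : bool).

(* Node [u] of [ed w] stands for the tape position [u + 1], which holds the label of the
   edge leaving [u] or the right endmarker; position 0 is the pair [(0, true)]. *)
Definition tpos w (u : 'I_(size w).+1) e : nat := if e then 0 else u.+1.

Definition scans w (u : gV (ed w)) e (a : tsym A) : Prop :=
  match a with
  | LEnd => e = true
  | REnd => e = false /\ ~ exists b, exists v, gE (ed w) u b v
  | Sym b => e = false /\ exists v, gE (ed w) u b v
  end.

(** Node 0 with flag [false] is tape position 1; so the moves between positions 0 and 1 keep the
    node and change only the flag. *)
Definition moves (d : dir) w (u : gV (ed w)) e (v : gV (ed w)) e' : Prop :=
  match d with
  | MStay => e = e' /\ u = v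
  | MRight => e' = false /\ (e = true /\ u = v \/ e = false /\ exists a, gE (ed w) u a v)
  | MLeft => e = false /\ (e' = false /\ (exists a, gE (ed w) v a u) \/
      e' = true /\ u = v /\ ~ exists a, exists t, gE (ed w) t a u)
  end.

Lemma scansE w u e a : @scans w u e a <-> tape w (tpos u e) = a.
Proof.
case: e => /=; first by case: a => //=; split=> // -[].
case E : onth => [b|]; case: a => [||a] //=.
- by split=> // -[_ []]; exists b; apply/ed_out.
- split=> [[_ /ed_out]|[<-]]; first by rewrite E => -[->].
  by split=> //; apply/ed_out.
- by split=> // _; split=> // -[b /ed_out]; rewrite E.
- by split=> // -[_ /ed_out]; rewrite E.
Qed.

Lemma ed_succ w (u v : gV (ed w)) : (exists a, gE (ed w) u a v) <-> v = u.+1 :> nat.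
Proof.
split=> [[a []]//|H]; have : (u : 'I_(size w).+1) < size w by rewrite -ltnS -H ltn_ord.
by rewrite -onthTE; case E : onth => [a|] // _; exists a.
Qed.

Lemma ed_first w (u : gV (ed w)) : (~ exists a, exists t, gE (ed w) t a u) <-> u = ord0.
Proof.
split=> [H|-> [a [t []]]//]; apply: ord_inj; case E : (nat_of_ord u) => [//|i]; case: H.
have Hi : i < (size w).+1 by rewrite ltnW // -E.
have [a Ha] := (@ed_succ w (Ordinal Hi) u).2 E; by exists a, (Ordinal Hi).
Qed.

Lemma moves_det d w u e v e' v' e'' : @moves d w u e v e' -> @moves d w u e v' e'' -> v = v' /\ e' = e''.
Proof.
case: d; cbn [moves].
- move=> [_ [[-> Hv]|[-> [<- H]]]] [_ [[-> Hv']|[-> [<- H']]]] //.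
  + split=> //; apply: ord_inj; apply: succn_inj.
    by move: Hv Hv' => /ed_succ <- /ed_succ <-.
  + by case: H'; have [a ?] := Hv; exists a, v.
  + by case: H; have [a ?] := Hv'; exists a, v'.
- by move=> [<- <-] [<- <-].
- move=> [-> [[-> <-]|[-> Hv]]] [-> [[Ee Hv']|[Ee Hv']]] //.
  by split=> //; apply: ord_inj; move: Hv Hv' => /ed_succ -> /ed_succ ->.
Qed.

(** The invariant [e -> u = ord0] makes the pair unique for its tape position, and moves preserve
    it. *)
Lemma movesP d w u e v e' : (e -> u = ord0) -> @moves d w u e v e' ->
  move w d (tpos u e) = Some (tpos v e') /\ (e' -> v = ord0).
Proof.
move=> He; case: d; cbn [moves move].
- move=> [Ee [[-> /ed_succ Hv]|[-> [<- /ed_first Hu]]]]; rewrite Ee /=.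
    by rewrite /tpos Hv.
  by rewrite Hu.
- by move=> [<- <-].
- move=> [-> [[Ee Huv]|[Ee /ed_succ Huv]]]; rewrite Ee /=; first by rewrite -Huv He.
  by rewrite ltnS Huv ifT // -ltnS -Huv ltn_ord.
Qed.

Lemma moves_exists d w u e j : (e -> u = ord0) -> move w d (tpos u e) = Some j ->
  exists v e', @moves d w u e v e' /\ j = tpos v e'.
Proof.
move=> He; case: d; cbn [moves move].
- case: e He => [//|] He [<-]; case E: (nat_of_ord u) => [|i].
    exists u, true; split=> //; split=> //; right; split=> //; split=> //.
    by apply/ed_first; apply: ord_inj.
  have Hi : i < (size w).+1 by rewrite ltnW // -E.
  exists (Ordinal Hi), false; split=> //; split=> //; left; split=> //.
  exact/ed_succ.
- by move=> [<-]; exists u, e.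
- case: e He => He.
    by move=> [<-]; exists u, false; rewrite He //; split=> //; split=> //; left.
  case: ifP => // Hu [<-].
  exists (Ordinal (Hu : (nat_of_ord u).+1 < (size w).+1)), false; split=> //; split=> //; right; split=> //.
  exact/ed_succ.
Qed.

Lemma Def_scans (c : ctx (@ed A)) t e a : Acc t -> @Def _ _ _ c (fun w env => scans (t w env) e a).
Proof. by move=> Ht; case: a => [||a]; cbn [scans]; repeat def1. Qed.

Lemma Def_moves (c : ctx (@ed A)) d t e t' e' : Acc t -> Acc t' ->
  @Def _ _ _ c (fun w env => moves d (t w env) e (t' w env) e').
Proof. by move=> Ht Ht'; case: d; cbn [moves]; repeat def1. Qed.
End TapePositions.

Lemma mem_In (T : Type) n (t : n.-tuple T) k : List.In (tnth t k) t.
Proof.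
have Hn x0 (s : seq T) i : i < size s -> List.In (nth x0 s i) s.
  by elim: s i => [|x s IH] [|i] //= Hi; [left|right; apply: IH].
by rewrite (tnth_nth (tnth t k)); apply: Hn; rewrite size_tuple.
Qed.

Lemma In_tnth (T : Type) (s : seq T) x : List.In x s -> exists k, x = tnth (in_tuple s) k.
Proof.
move=> H; suff [i Hi Hx] : exists2 i, i < size s & nth x s i = x.
  by exists (Ordinal Hi); rewrite (tnth_nth x).
elim: s H => [//|y s IH] [->|/IH[i Hi Hx]]; [by exists 0|by exists i.+1].
Qed.

Section TwoWay.
Variables (A B : finType) (M : gsm2 A B).
Variables (S : finType) (mul : S -> S -> S) (h : seq B -> S) (F : S -> Prop).
Hypothesis h_mul : recognizes mul h.

Local Notation K := (bool * gQ M * S)%type.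
Local Notation I := ('I_(size (g_delta M)) * bool)%type.

Let ins (k : 'I_(size (g_delta M))) := tnth (in_tuple (g_delta M)) k.
Definition word_of (i : I) : seq B := if i.2 then i_out1 (ins i.1) else i_out0 (ins i.1).
Let dir_of (i : I) := if i.2 then i_d1 (ins i.1) else i_d0 (ins i.1).
Let target (i : I) := if i.2 then i_q1 (ins i.1) else i_q0 (ins i.1).

(** The label [i] contains the outcome of the test, so it determines the written word, and the
    string of labels determines the output. The component in [S] accumulates the value of that
    output. *)
Definition tstep (w : seq A) (x : gV (ed w) * K) (i : I) (y : gV (ed w) * K) : Prop :=
  i_p (ins i.1) = x.2.1.2 /\
  (i.2 = true /\ scans x.1 x.2.1.1 (i_sym (ins i.1)) \/
   i.2 = false /\ ~ scans x.1 x.2.1.1 (i_sym (ins i.1))) /\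
  moves (dir_of i) x.1 x.2.1.1 y.1 y.2.1.1 /\
  y.2.1.2 = target i /\ y.2.2 = mul x.2.2 (h (word_of i)).

Definition tinit (w : seq A) (x : gV (ed w) * K) : Prop :=
  x.2 = (true, g_qin M, h [::]) /\ ~ exists a, exists t, gE (ed w) t a x.1.

Definition tfinal (w : seq A) (x : gV (ed w) * K) : Prop := x.2.1.2 = g_qf M /\ F x.2.2.

Lemma tstep_det (w : seq A) (x y y' : gV (ed w) * K) i : tstep x i y -> tstep x i y' -> y = y'.
Proof.
case: y y' => [v [[e q] s]] [v' [[e' q'] s']] [_ [_ [/= H1 [-> ->]]]] [_ [_ [/= H2 [-> ->]]]].
by have [-> ->] := moves_det H1 H2.
Qed.

Lemma tinit_unique (w : seq A) (x y : gV (ed w) * K) : tinit x -> tinit y -> x = y.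
Proof. by case: x y => [u k] [v k'] [/= -> /ed_first ->] [/= -> /ed_first ->]. Qed.

Lemma tstep_def k i k' : @Def2 _ _ (@ed A) (fun w u v => tstep (u, k) i (v, k')).
Proof.
rewrite /Def2 /tstep; cbn [fst snd].
repeat first [eapply Def_scans; acc | eapply Def_moves; acc | def1].
Qed.

Lemma tinit_def k : @Def1 _ _ (@ed A) (fun w u => @tinit w (u, k)).
Proof. by rewrite /Def1 /tinit; cbn [fst snd]; repeat def1. Qed.

Lemma tfinal_def k : @Def1 _ _ (@ed A) (fun w u => @tfinal w (u, k)).
Proof. exact: (Def_const _ (k.1.2 = g_qf M /\ F k.2)). Qed.

Let represents (w : seq A) (x : gV (ed w) * K) (c : config M) : Prop :=
  [/\ c.1.1 = x.2.1.2, c.1.2 = tpos (w := w) x.1 x.2.1.1, x.2.2 = h c.2 & (x.2.1.1 -> x.1 = ord0)].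

Let tstep_gstep (w : seq A) (x y : gV (ed w) * K) i c : represents x c -> tstep x i y ->
  exists2 c', gstep w c c' & represents y c' /\ c'.2 = c.2 ++ word_of i.
Proof.
case: c => -[p j] o [/= Hp Hj Hs Hx] [H1 [H2 [H3 [H4 H5]]]].
have [Hm Hy] := movesP Hx H3.
exists (target i, tpos (w := w) y.1 y.2.1.1, o ++ word_of i); last first.
  by split=> //; split=> //=; rewrite H5 Hs h_mul.
exists (ins i.1); split; first by exact: (mem_In (in_tuple _)).
split; first by rewrite H1.
move: Hm; rewrite /target /dir_of /word_of Hj; case: H2 => -[-> /scansE Hsc] Hm; [left|right].
  by split=> //; exists (tpos (w := w) y.1 y.2.1.1).
by split=> //; exists (tpos (w := w) y.1 y.2.1.1).
Qed.

Let gstep_tstep (w : seq A) (x : gV (ed w) * K) c c' : represents x c -> gstep w c c' ->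
  exists i y, [/\ tstep x i y, represents y c' & c'.2 = c.2 ++ word_of i].
Proof.
case: x c => [u [[e q] s]] [[p j] o] [/= Hp Hj Hs Hx] [a [HIn [Ha Hd]]].
have [k Hk] := In_tnth HIn.
case: Hd => -[]; rewrite Hj Hk => Hsc [j' [/(moves_exists Hx)[v [e' [Hm Hj']]] Hc']].
  exists (k, true), (v, (e', i_q1 (ins k), mul s (h (i_out1 (ins k))))).
  have Hv := (movesP Hx Hm).2; split; last by rewrite Hc'.
    split; first by rewrite /= -Hp -Ha Hk.
    by split; [left; split=> //; apply/scansE|].
  by split; rewrite ?Hc' //= h_mul Hs.
exists (k, false), (v, (e', i_q0 (ins k), mul s (h (i_out0 (ins k))))).
have Hv := (movesP Hx Hm).2; split; last by rewrite Hc'.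
  split; first by rewrite /= -Hp -Ha Hk.
  by split; [right; split=> // /scansE|].
by split; rewrite ?Hc' //= h_mul Hs.
Qed.

Let walk_steps (w : seq A) y (x l : gV (ed w) * K) c : represents x c -> walk (@tstep w) x y l ->
  exists2 c', clos_refl_trans _ (@gstep _ _ M w) c c' &
    represents l c' /\ c'.2 = c.2 ++ flatten (map word_of y).
Proof.
elim: y x c => [|i y IH] x c Hc /=.
  by move=> <-; exists c; [exact: rt_refl|rewrite cats0].
move=> [x' Hx' Hw0]; have [c1 Hc1 [Hr1 Ho1]] := tstep_gstep Hc Hx'.
have [c2 Hc2 [Hr2 Ho2]] := IH _ _ Hr1 Hw0.
exists c2; first by apply: rt_trans Hc2; exact: rt_step.
by split=> //; rewrite Ho2 Ho1 catA.
Qed.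

Let steps_walk (w : seq A) (x : gV (ed w) * K) c c' : represents x c ->
  clos_refl_trans _ (@gstep _ _ M w) c c' ->
  exists y l, [/\ walk (@tstep w) x y l, represents l c' & c'.2 = c.2 ++ flatten (map word_of y)].
Proof.
move=> Hx /(@clos_rt_rt1n _ _ _ _) H; elim: H x Hx => {c c'} [c|c1 c2 c3 H12 _ IH] x Hx.
  by exists [::], x; rewrite cats0.
have [i [x' [Hxx' Hr Ho]]] := gstep_tstep Hx H12.
have [y [l [Hw Hl Ho']]] := IH _ Hr.
exists (i :: y), l; split=> //; first by exists x'.
by rewrite Ho' Ho /= catA.
Qed.

Let start (w : seq A) : gV (ed w) * K := (ord0, (true, g_qin M, h [::])).

Lemma tinit_start (w : seq A) : tinit (start w).
Proof. by split=> //; apply/ed_first. Qed.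

Let represents_start (w : seq A) : represents (start w) (g_qin M, 0, [::]).
Proof. by []. Qed.

(** Walks between vertices and computations correspond, with outputs read off the labels. Any
    accepting computation with value in [F] yields a valid strategy, and the chosen walk again ends
    with a value in [F]. *)
Lemma gsm_uniformization : exists m : transduction A B, [/\ string_mso m,
  forall w z, m w z -> realized M w z /\ F (h z) &
  forall w z, realized M w z -> F (h z) -> exists z', m w z'].
Proof.
pose m1 := chosen tstep tinit tfinal.
have m1_mso : string_mso m1.
  exact: chosen_mso tstep_def tinit_def tfinal_def tstep_det tinit_unique.
exists (tcomp m1 (fun y z => z = flatten (map word_of y))); split.
- exact: string_mso_comp m1_mso (hom_mso word_of).
- move=> w _ [y [/chosen_sound[x [l [Ix [Fq Fs] Hw]]] ->]].
  rewrite (tinit_unique Ix (tinit_start w)) in Hw.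
  have [c' Hc' [[Hp Hj Hs _] Ho]] := walk_steps (represents_start w) Hw.
  rewrite -[flatten _]/([::] ++ flatten (map word_of y)) -Ho -Hs; split=> //.
  by exists c'.1.2; rewrite -Fq -Hp -!surjective_pairing.
- move=> w z [j Hj] Fz; have [y [l [Hw [Hp _ Hs _] Ho]]] := steps_walk (represents_start w) Hj.
  have [|y' Hy'] := chosen_total (Fin := tfinal) (tinit_start w) _ Hw.
    by split; [rewrite -Hp|rewrite Hs].
  by exists (flatten (map word_of y')), y'.
Qed.

End TwoWay.

(** * Composing the chosen parts *)

Section UnmarkedWords.
Variable A : Type.

Definition plain (a : option A) : letter A := (a, fun _ => False, fun _ => False).

Definition plain_word (w : seq A) : seq (letter A) := rcons [seq plain (Some a) | a <- w] (plain None).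

Lemma onth_plain_word (w : seq A) (i : 'I_(size w).+1) : onth (plain_word w) i = Some (plain (onth w i)).
Proof.
rewrite /plain_word -cats1 onth_cat size_map; case: ltnP => Hi.
  by rewrite onth_map; move: Hi; rewrite -onthTE; case: onth.
have Ei : i = size w :> nat by apply/eqP; rewrite eqn_leq Hi -ltnS ltn_ord.
by rewrite [in RHS]onth_default Ei ?subnn.
Qed.

Lemma plain_word_map (w : seq A) :
  plain_word w = [seq plain (onth w (nat_of_ord i)) | i <- enum 'I_(size w).+1].
Proof.
apply: eq_from_onth_le => i.
rewrite size_rcons 2!size_map size_enum_ord maxnn => Hi.
have -> := (onth_map_ord (fun j : 'I_(size w).+1 => plain (onth w j)) i (plain (onth w i))).2.
  exact: (onth_plain_word (Ordinal Hi)).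
by exists (Ordinal Hi).
Qed.

Lemma encode_plain (w : seq A) : encode (w := w) (@nu0 _) (@mu0 _) = plain_word w.
Proof.
rewrite plain_word_map; apply: eq_map => i; rewrite /encode_at /plain.
by congr (_, _, _); apply: funext => x; apply: propext; split.
Qed.
End UnmarkedWords.

(** A closed formula sees no marks, so letters of [A] can be relabelled directly. A path has one
    node more than the word has letters; the right quotient by [plain None] removes it. *)
Lemma Def0_Rec (A : Type) (P : seq A -> Prop) : Def0 (@ed A) P -> Rec P.
Proof.
move=> [f [_ [_ Hf]]]; have [L RL HL] := mso_recognizable f.
apply: Rec_ext (Rec_map (fun a => plain (Some a)) (Rec_rquotient [:: plain None] RL)) => w.
by rewrite -(Hf w tt) HL encode_plain /plain_word cats1.
Qed.

Lemma NGSMk_uniformization k (A B : finType) (m : transduction A B) L : NGSMk k m -> Rec L ->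
  exists m' : transduction A B, [/\ string_mso m',
  forall w z, m' w z -> m w z /\ L z & forall w z, m w z -> L z -> exists z', m' w z'].
Proof.
have base (A' B' : finType) (m0 : transduction A' B') L0 : inNGSM m0 -> Rec L0 ->
  exists m' : transduction A' B', [/\ string_mso m',
  forall w z, m' w z -> m0 w z /\ L0 z & forall w z, m0 w z -> L0 z -> exists z', m' w z'].
  move=> [M HM] [S [mul [h [Hh [F HF]]]]].
  have [m' [H1 H2 H3]] := gsm_uniformization M F Hh.
  exists m'; split=> // w z; first by move/H2; rewrite HM HF.
  by rewrite HM HF; exact: H3.
elim: k B m L => [//|[|k] IH] B m L /=; first exact: base.
move=> [C [m1 [m2 [H1 [H2 Hm]]]]] RL.
have [m2' [H2' Hs2 Ht2]] := base _ _ _ _ H2 RL.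
have [_ [_ [_ [_ [D2 _ _ _]]]]] := H2'.
(* The remaining factors are restricted to the domain of [m2'], so that no word they select blocks
   the last factor. *)
have [m1' [H1' Hs1 Ht1]] := IH _ _ _ H1 (Def0_Rec D2).
exists (tcomp m1' m2'); split; first exact: string_mso_comp.
- move=> w z [y [/Hs1[Hy _] /Hs2[Hz Lz]]]; split=> //; apply/Hm; by exists y.
- move=> w z /Hm[y [Hy Hz]] Lz; have [z' Hz'] := Ht2 _ _ Hz Lz.
  have [|y' Hy'] := Ht1 _ _ Hy; first by exists z'.
  have [_ [z'' Hz'']] := Hs1 _ _ Hy'; by exists z'', y'.
Qed.

Lemma functional_NGSMk_string_mso k (A B : finType) (m : transduction A B) :
  NGSMk k m -> functional m -> string_mso m.
Proof.
move=> Hk Hf; have [|m' [H1 H2 H3]] := NGSMk_uniformization Hk (L := fun _ => True).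
  exists unit, (fun _ _ => tt), (fun _ => tt); split=> //; by exists (fun _ => True).
suff -> : m = m' by [].
apply: funext => w; apply: funext => z; apply: propext; split=> [Hz|/H2[]//].
have [z' Hz'] := H3 w z Hz I; by rewrite (Hf _ _ _ Hz (H2 _ _ Hz').1).
Qed.

(** * From MSO definitions to two-way machines *)

Lemma In_mem (T : eqType) (x : T) s : List.In x s <-> x \in s.
Proof.
elim: s => [//|y s IH]; rewrite inE /=; split=> [[->|/IH->]|/orP[/eqP->|/IH]]; rewrite ?eqxx ?orbT //; by auto.
Qed.

(** * Machines given by a transition relation *)

Section Nondeterministic.
Variables (A B Q : finType) (qi qf : Q).
Variable Delta : Q -> tsym A -> Q -> option B -> dir -> Prop.

Definition nstep (w : seq A) (c : Q * nat) (o : option B) (c' : Q * nat) : Prop :=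
  c.1 <> qf /\ exists2 d, Delta c.1 (tape w c.2) c'.1 o d & move w d c.2 = Some c'.2.

Let symbol (a : option (option A)) : tsym A :=
  if a is Some a' then if a' is Some b then Sym b else REnd else LEnd.
Let direction (d : option bool) : dir :=
  if d is Some d' then if d' then MRight else MLeft else MStay.

Let symbolK a : exists a', a = symbol a'.
Proof. by case: a => [||a]; [exists None|exists (Some None)|exists (Some (Some a))]. Qed.

Let directionK d : exists d', d = direction d'.
Proof. by case: d; [exists (Some false)|exists None|exists (Some true)]. Qed.

Local Notation transition := (Q * option (option A) * Q * option B * option bool)%type.

(* [None] is a dead state, entered when the scanned symbol is not the expected one. *)
Let instruction (t : transition) : instr (option Q) A B :=
  let: (p, a, q, o, d) := t in
  {| i_p := Some p; i_sym := symbol a; i_q1 := Some q; i_out1 := seq_of_opt o; i_d1 := direction d;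
     i_q0 := None; i_out0 := [::]; i_d0 := MStay |}.

Let allowed (t : transition) : Prop :=
  let: (p, a, q, o, d) := t in p <> qf /\ Delta p (symbol a) q o (direction d).

Let program := [seq instruction t | t <- enum {: transition} & `[< allowed t >]].

Let In_program x : List.In x program <-> exists2 t, x = instruction t & allowed t.
Proof.
rewrite List.in_map_iff; split=> [[t [<- /In_mem]]|[t -> Ht]].
  by rewrite mem_filter => /andP[/asboolP Ht _]; exists t.
by exists t; split=> //; apply/In_mem; rewrite mem_filter mem_enum andbT; apply/asboolP.
Qed.

Let program_ok : all (fun x => i_p x != Some qf) program.
Proof.
rewrite all_map; apply/allP => -[[[[p a] q] o] d]; rewrite mem_filter => /andP[/asboolP[Hp _] _].
by apply/eqP => -[].
Qed.

Definition machine : gsm2 A B := @Gsm2 A B (option Q) (Some qi) (Some qf) program program_ok.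

Let gstep_machine w p i o (c' : config machine) : gstep w ((Some p, i, o) : config machine) c' <->
  c' = (None, i, o) /\ (exists a q x d, [/\ p <> qf, Delta p a q x d & tape w i <> a]) \/
  exists q j x, c' = (Some q, j, o ++ seq_of_opt x) /\ nstep w (p, i) x (q, j).
Proof.
split=> [[y [/In_program[[[[[p' a] q] x] d] -> [Hp HD]] [/= [Epp] Hy]]]|].
  rewrite -Epp; case: Hy => -[Ha [j [Hj ->]]]; [right|left].
    by exists q, j, x; split=> //; split=> //; exists (direction d) => //=; rewrite Ha.
  by move: Hj => -[<-]; rewrite cats0; split=> //; exists (symbol a), q, x, (direction d).
move=> [[-> [a [q [x [d [Hp HD Ha]]]]]]|[q [j [x [-> [Hp [d HD Hj]]]]]]].
  have [a' Ea] := symbolK a; have [d' Ed] := directionK d.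
  exists (instruction (p, a', q, x, d')); split; first by apply/In_program; exists (p, a', q, x, d'); rewrite /= -?Ea -?Ed.
  by split=> //; right; rewrite /= -Ea; split=> //; exists i; rewrite cats0.
have [a' Ea] := symbolK (tape w i); have [d' Ed] := directionK d.
exists (instruction (p, a', q, x, d')); split.
  by apply/In_program; exists (p, a', q, x, d'); rewrite /= -?Ea -?Ed.
by split=> //; left; rewrite /= -Ea -Ed; split=> //; exists j.
Qed.

Let gstep_dead w i o (c' : config machine) : ~ gstep w ((None, i, o) : config machine) c'.
Proof. by move=> [y [/In_program[[[[[p' a] q] x] d] -> _] []]]. Qed.

(** The dead state has no instructions and is not final, so accepting computations are exactly the
    walks of [nstep]. *)
Lemma machineP w z : realized machine w z <->
  exists j y, walk (nstep w) (qi, 0) y (qf, j) /\ z = pmap id y.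
Proof.
have pmap_cons (x : option B) y : pmap id (x :: y) = seq_of_opt x ++ pmap id y by case: x.
split=> [[j /(@clos_rt_rt1n _ _ _ _) H]|[j [y [Hw ->]]]].
- suff G (c c' : config machine) : clos_refl_trans_1n _ (@gstep _ _ machine w) c c' ->
      forall p i o q j' o', c = (Some p, i, o) -> c' = (Some q, j', o') ->
      exists y, walk (nstep w) (p, i) y (q, j') /\ o' = o ++ pmap id y.
    by have [y [Hw Hz]] := G _ _ H _ _ _ _ _ _ erefl erefl; exists j, y.
  elim=> {c c'} [c|c1 c2 c3 H1 H2 IH] p i o q j' o' E1 E2.
    by move: E2; rewrite E1 => -[-> -> ->]; exists [::]; rewrite cats0.
  move: H1; rewrite E1 => /gstep_machine[[Ec2 _]|[q1 [j1 [x [Ec2 Hx]]]]].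
    exfalso; move: H2 E2; rewrite Ec2 => H2; case: H2; first by [].
    by move=> c4 c5 /gstep_dead.
  have [y [Hy ->]] := IH _ _ _ _ _ _ Ec2 E2.
  by exists (x :: y); rewrite pmap_cons catA; split=> //; exists (q1, j1).
- exists j; suff G o p i : walk (nstep w) (p, i) y (qf, j) ->
      clos_refl_trans _ (@gstep _ _ machine w) (Some p, i, o) (Some qf, j, o ++ pmap id y).
    exact: (G [::]).
  elim: y o p i {Hw} => [|x y IH] o p i /=; first by move=> [-> ->]; rewrite cats0; exact: rt_refl.
  move=> [[p1 i1] Hx /(IH (o ++ seq_of_opt x))]; rewrite -[oapp _ _ _]/(pmap id (x :: y)) pmap_cons catA.
  apply: rt_trans; apply: rt_step; apply/gstep_machine; right.
  by exists p1, i1, x.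
Qed.

End Nondeterministic.

(** * Words with two marked positions *)

Section MarkedWords.
Variable A : Type.

Definition marked (a : option A) (b0 b1 : bool) : letter A :=
  (a, (fun x => x = 0 /\ b0 \/ x = 1 /\ b1), fun _ => False).

(** A factor of the encoded word, with variables 0 and 1 placed by [g0] and [g1]. Position [size w]
    is the last node, where [onth] gives [None]. Consecutive ranges make the splitting of values a
    concatenation. *)
Definition segment (w : seq A) (g0 g1 : pred nat) i n : seq (letter A) :=
  [seq marked (onth w k) (g0 k) (g1 k) | k <- iota i n].

Lemma segmentD w g0 g1 i m n :
  segment w g0 g1 i (m + n) = segment w g0 g1 i m ++ segment w g0 g1 (i + m) n.
Proof. by rewrite /segment iotaD map_cat. Qed.

Lemma segmentS w g0 g1 i n :
  segment w g0 g1 i n.+1 = [:: marked (onth w i) (g0 i) (g1 i)] ++ segment w g0 g1 i.+1 n.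
Proof. by []. Qed.

Lemma eq_segment w g0 g1 g0' g1' i n :
  (forall k, i <= k < i + n -> g0 k = g0' k /\ g1 k = g1' k) ->
  segment w g0 g1 i n = segment w g0' g1' i n.
Proof. by move=> H; apply/eq_in_map => k; rewrite mem_iota => /H[-> ->]. Qed.

Lemma segment_split w g0 g1 v : v < (size w).+1 ->
  segment w g0 g1 0 (size w).+1 = segment w g0 g1 0 v ++
    [:: marked (onth w v) (g0 v) (g1 v)] ++ segment w g0 g1 v.+1 (size w - v).
Proof. by move=> Hv; rewrite -{1}(subnKC (ltnW Hv)) segmentD add0n subSn. Qed.

Lemma enum_segment w (g0 g1 : pred nat) (f : 'I_(size w).+1 -> letter A) :
  (forall i, f i = marked (onth w i) (g0 i) (g1 i)) ->
  map f (enum 'I_(size w).+1) = segment w g0 g1 0 (size w).+1.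
Proof.
move=> Hf; rewrite /segment -val_enum_ord -map_comp; apply: eq_map => i; exact: Hf.
Qed.

Lemma encode1 (w : seq A) (u : 'I_(size w).+1) :
  encode (nu1 u) (@mu0 _) = segment w (pred1 (nat_of_ord u)) pred0 0 (size w).+1.
Proof.
apply: enum_segment => i; rewrite /encode_at /marked; congr (_, _, _).
apply: funext => x; apply: propext; rewrite /nu1 /upd /nu0; case: x => [|[|x]] /=.
- by split=> [[->]|[[_ /eqP H]|[]]] //; [left|congr Some; apply: ord_inj].
- by split=> // -[[]|[]].
- by split=> // -[[]|[]].
Qed.

Lemma encode2 (w : seq A) (u v : 'I_(size w).+1) :
  encode (nu2 u v) (@mu0 _) = segment w (pred1 (nat_of_ord u)) (pred1 (nat_of_ord v)) 0 (size w).+1.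
Proof.
apply: enum_segment => i; rewrite /encode_at /marked; congr (_, _, _).
apply: funext => x; apply: propext; rewrite /nu2 /nu1 /upd /nu0; case: x => [|[|x]] /=.
- by split=> [[->]|[[_ /eqP H]|[]]] //; [left|congr Some; apply: ord_inj].
- by split=> [[->]|[[]|[_ /eqP H]]] //; [right|congr Some; apply: ord_inj].
- by split=> // -[[]|[]].
Qed.
End MarkedWords.

(** * The annotating machine and the walking machine *)

Section Walker.
Variables (A B C : finType).
Variables (Start Last : C -> forall w : seq A, gV (ed w) -> Prop).
Variable G : C -> C -> B -> forall w : seq A, gV (ed w) -> gV (ed w) -> Prop.
Variables (M : finType) (mul : M -> M -> M) (h : seq (letter A) -> M).
Hypothesis h_mul : recognizes mul h.
Variables (FS FL : C -> M -> Prop) (FG : C * C * B -> M -> Prop).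
Hypothesis FS_P : forall c w (u : gV (ed w)),
  Start c u <-> FS c (h (segment w (pred1 (nat_of_ord u)) pred0 0 (size w).+1)).
Hypothesis FL_P : forall c w (u : gV (ed w)),
  Last c u <-> FL c (h (segment w (pred1 (nat_of_ord u)) pred0 0 (size w).+1)).
Hypothesis FG_P : forall c c' b w (u v : gV (ed w)), G c c' b u v <->
  FG (c, c', b) (h (segment w (pred1 (nat_of_ord u)) (pred1 (nat_of_ord v)) 0 (size w).+1)).

Local Notation gamma := (M * option A * M)%type.

(** Both values are of unmarked factors: the marks enter later, through the letter between them. *)
Definition annotation (w : seq A) v : gamma :=
  (h (segment w pred0 pred0 0 v), onth w v, h (segment w pred0 pred0 v.+1 (size w - v))).

Definition annotate (w : seq A) : seq gamma := map (annotation w) (iota 0 (size w).+1).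

Section Annotate.
Local Notation Q := (option (option (M * M))).
Let Qi : Q := None.
Let Qf : Q := Some None.
Local Notation Qr l r := (Some (Some (l, r)) : Q).
Let plain1 (a : option A) := h [:: marked a false false].

(** In state [Qr l r], [l] is the value of the nodes already passed and [r] a guess for the value of
    the rest. Each step guesses the next rest [r'] consistently with [r]; the right endmarker, which
    stands for the last node, verifies the guess. *)
Let Delta (p : Q) (a : tsym A) (q : Q) (o : option gamma) (d : dir) : Prop :=
  match p, a, q with
  | None, LEnd, Some (Some (l, r)) => [/\ l = h [::], o = None & d = MRight]
  | Some (Some (l, r)), Sym b, Some (Some (l', r')) =>
      [/\ l' = mul l (plain1 (Some b)), r = mul (plain1 (Some b)) r', o = Some (l, Some b, r') & d = MRight]
  | Some (Some (l, r)), REnd, Some None =>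
      [/\ r = mul (plain1 None) (h [::]), o = Some (l, None, h [::]) & d = MStay]
  | _, _, _ => False
  end.

Let suffix w i := h (segment w pred0 pred0 i ((size w).+1 - i)).

Let suffixS w i : i <= size w -> suffix w i = mul (plain1 (onth w i)) (suffix w i.+1).
Proof. by move=> Hi; rewrite /suffix subSn // segmentS h_mul. Qed.

Let suffix_end w : suffix w (size w).+1 = h [::].
Proof. by rewrite /suffix subnn. Qed.

Let prefixS w i : h (segment w pred0 pred0 0 i.+1) = mul (h (segment w pred0 pred0 0 i)) (plain1 (onth w i)).
Proof. by rewrite -addn1 segmentD h_mul. Qed.

Let annotation_suffix w i : annotation w i = (h (segment w pred0 pred0 0 i), onth w i, suffix w i.+1).
Proof. by rewrite /annotation /suffix subSS. Qed.

Let run w i y r j : i <= size w ->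
  walk (nstep Qf Delta w) (Qr (h (segment w pred0 pred0 0 i)) r, i.+1) y (Qf, j) <->
  [/\ r = suffix w i, y = [seq Some (annotation w k) | k <- iota i ((size w).+1 - i)] & j = (size w).+1].
Proof.
move En: (size w - i) => n; elim: n i y r En => [|n IH] i y r En Hi.
  have {En Hi}-> : i = size w by apply/eqP; rewrite eqn_leq Hi -subn_eq0 En.
  rewrite subSnn; have HS := suffixS (leqnn (size w)).
  rewrite suffix_end onth_default // in HS; split.
    case: y => [//|x y] [[q i1] [_ [d /=]]]; rewrite onth_default //.
    case: q => [[[l r']|]|] //= [-> -> ->] [<-] Hy.
    have {Hy} [-> ->] : y = [::] /\ j = (size w).+1.
      by case: y Hy => [[]|x' y' [c' []]].
    by split=> //; rewrite /= annotation_suffix suffix_end onth_default.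
  move=> [-> -> ->]; exists (Qf, (size w).+1) => //; split=> //; exists MStay => //=.
  by rewrite onth_default // annotation_suffix suffix_end onth_default.
have Hi' : i < size w by rewrite -subn_gt0 En.
have [b Hb] : exists b, onth w i = Some b by move: Hi'; rewrite -onthTE; case: (onth w i) => // b; exists b.
have En' : size w - i.+1 = n by rewrite subnS En.
have Hs := suffixS Hi; have Hp := prefixS w i; rewrite Hb in Hs Hp.
split.
  case: y => [//|x y] [[q i1] [_ [d /=]]]; rewrite Hb.
  case: q => [[[l r']|]|] //= [-> -> -> ->] /=; case: ifP => // _ [<-].
  rewrite -Hp => /(IH _ _ _ En' Hi')[-> -> ->].
  by rewrite subSS (subSn Hi) /=; split=> //; rewrite annotation_suffix Hb.
move=> [-> -> Ej]; rewrite (subSn Hi) /=; exists (Qr (h (segment w pred0 pred0 0 i.+1)) (suffix w i.+1), i.+2).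
  split=> //; exists MRight; rewrite /= ?Hb; last by rewrite ifT // ltnS.
  by split=> //; rewrite annotation_suffix Hb.
by apply: (IH _ _ _ En' Hi').2; rewrite subSS.
Qed.

Lemma annotate_gsm : inNGSM (fun w z => z = annotate w).
Proof.
exists (machine Qi Qf Delta) => w z; rewrite machineP; split=> [->|[j [y [Hw ->]]]].
  exists (size w).+1, (None :: [seq Some (annotation w k) | k <- iota 0 (size w).+1]); split.
    exists (Qr (h [::]) (suffix w 0), 1); last by apply/(@run w 0).
    by split=> //; exists MRight.
  by rewrite /annotate /=; congr cons; elim: (iota 1 _) => //= k s ->.
case: y Hw => [[]|x y] //= [[q i] [_ [d /=]]].
case: q => [[[l r]|]|] //= [-> -> ->] [<-] /(@run w 0)[] // _ -> _.
by rewrite /annotate /=; congr cons; elim: (iota 1 _) => //= k s ->.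
Qed.
End Annotate.

Local Notation Q := (bool + (C + bool * (C * C * B) * M))%type.
Local Notation SI := (inl false).
Local Notation SF := (inl true).
Local Notation At c := (inr (inl c)).
Local Notation Going d e t := (inr (inr (d, e, t))).

(* In state [Going d (c, c', b) t] the head has left a node [u] of copy [c] and looks, to the
   right if [d], for a node [v] of copy [c'] with a [b]-edge from [u]; [t] is the value of the
   part of the word, with [u] marked, on the side of [u] of the head. *)
Let Delta (p : Q) (a : tsym gamma) (q : Q) (o : option B) (d : dir) : Prop :=
  match p, q, a with
  | SI, SI, _ => o = None /\ d = MRight
  | SI, At c, Sym (l, x, r) =>
      [/\ FS c (mul l (mul (h [:: marked x true false]) r)), o = None & d = MStay]
  | At c, SF, Sym (l, x, r) =>
      [/\ FL c (mul l (mul (h [:: marked x true false]) r)), o = None & d = MStay]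
  | At c, At c', Sym (l, x, r) => exists b,
      [/\ FG (c, c', b) (mul l (mul (h [:: marked x true true]) r)), o = Some b & d = MStay]
  | At c, Going true e t, Sym (l, x, r) =>
      [/\ e.1.1 = c, t = mul l (h [:: marked x true false]), o = None & d = MRight]
  | At c, Going false e t, Sym (l, x, r) =>
      [/\ e.1.1 = c, t = mul (h [:: marked x true false]) r, o = None & d = MLeft]
  | Going true e t, Going true e' t', Sym (l, x, r) =>
      [/\ e' = e, t' = mul t (h [:: marked x false false]), o = None & d = MRight]
  | Going false e t, Going false e' t', Sym (l, x, r) =>
      [/\ e' = e, t' = mul (h [:: marked x false false]) t, o = None & d = MLeft]
  | Going true e t, At c, Sym (l, x, r) =>
      [/\ c = e.1.2, FG e (mul t (mul (h [:: marked x false true]) r)), o = Some e.2 & d = MStay]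
  | Going false e t, At c, Sym (l, x, r) =>
      [/\ c = e.1.2, FG e (mul l (mul (h [:: marked x false true]) t)), o = Some e.2 & d = MStay]
  | _, _, _ => False
  end.

Section OneWord.
Variable w : seq A.
Local Notation n := (size w).
Local Notation vertex := (gV (ed w) * C)%type.

Definition Gw (x : vertex) (b : B) (y : vertex) := G x.2 y.2 b x.1 y.1.

Definition linked (z : seq B) := exists x l : vertex, [/\ Start x.2 x.1, Last l.2 l.1 & walk Gw x z l].

Let size_annotate : size (annotate w) = n.+1.
Proof. by rewrite size_map size_iota. Qed.

Let tape_annotate i : i <= n -> tape (annotate w) i.+1 = Sym (annotation w i).
Proof.
move=> Hi; rewrite /= onthE (nth_map (annotation w 0)) ?size_annotate //.
by rewrite (nth_map 0) ?size_iota // nth_iota.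
Qed.

Let tape_Sym i l x r : tape (annotate w) i = Sym (l, x, r) -> exists k : 'I_n.+1,
  [/\ i = k.+1, l = h (segment w pred0 pred0 0 k), x = onth w k &
      r = h (segment w pred0 pred0 k.+1 (n - k))].
Proof.
case: i => [//|i] Hi; case: (ltnP i n.+1) => Hin.
  by exists (Ordinal Hin); move: Hi; rewrite tape_annotate // => -[<- <- <-].
by move: Hi; rewrite /= onth_default // size_annotate.
Qed.

(** Covers a single mark at [u] (with [g1] empty) as well as both marks at [u], the case of an edge
    between two copies of one node. *)
Let h_node (u : 'I_n.+1) (g1 : pred nat) : (forall k : nat, k != u -> g1 k = false) ->
  h (segment w (pred1 (u : nat)) g1 0 n.+1) =
  mul (h (segment w pred0 pred0 0 u))
    (mul (h [:: marked (onth w u) true (g1 u)]) (h (segment w pred0 pred0 u.+1 (n - u)))).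
Proof.
move=> Hg; rewrite (@segment_split _ _ _ _ u) // !h_mul /= eqxx.
congr (mul (h _) (mul _ (h _))); apply: eq_segment => k /andP[H1 H2].
  have ku : k != u by rewrite neq_ltn H2.
  by rewrite Hg //= (negbTE ku).
have ku : k != u by rewrite neq_ltn H1 orbT.
by rewrite Hg //= (negbTE ku).
Qed.

Let h_right (u v : 'I_n.+1) : u < v ->
  h (segment w (pred1 (u : nat)) (pred1 (v : nat)) 0 n.+1) =
  mul (h (segment w (pred1 (u : nat)) pred0 0 v))
    (mul (h [:: marked (onth w v) false true]) (h (segment w pred0 pred0 v.+1 (n - v)))).
Proof.
move=> uv; rewrite (@segment_split _ _ _ _ v) // !h_mul /= eqxx.
have -> : (v == u :> nat) = false by rewrite gtn_eqF.
congr (mul (h _) (mul _ (h _))); apply: eq_segment => k /andP[H1 H2] /=.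
  by rewrite (ltn_eqF H2).
by rewrite !gtn_eqF // (ltn_trans uv).
Qed.

Let h_left (u v : 'I_n.+1) : v < u ->
  h (segment w (pred1 (u : nat)) (pred1 (v : nat)) 0 n.+1) =
  mul (h (segment w pred0 pred0 0 v))
    (mul (h [:: marked (onth w v) false true]) (h (segment w (pred1 (u : nat)) pred0 v.+1 (n - v)))).
Proof.
move=> vu; rewrite (@segment_split _ _ _ _ v) // !h_mul /= eqxx.
have -> : (v == u :> nat) = false by rewrite ltn_eqF.
congr (mul (h _) (mul _ (h _))); apply: eq_segment => k /andP[H1 H2] /=.
  by rewrite !ltn_eqF // (ltn_trans H2).
by rewrite (gtn_eqF H1).
Qed.

Let h_leave_right (u : 'I_n.+1) :
  mul (h (segment w pred0 pred0 0 u)) (h [:: marked (onth w u) true false]) =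
  h (segment w (pred1 (u : nat)) pred0 0 u.+1).
Proof.
rewrite -[(nat_of_ord u).+1]addn1 segmentD h_mul /segment /= eqxx.
by congr (mul (h _) _); apply: eq_segment => k /andP[_ H] /=; rewrite ltn_eqF.
Qed.

Let h_leave_left (u : 'I_n.+1) :
  mul (h [:: marked (onth w u) true false]) (h (segment w pred0 pred0 u.+1 (n - u))) =
  h (segment w (pred1 (u : nat)) pred0 u (n.+1 - u)).
Proof.
rewrite (subSn (ltn_ord u : u <= n)) segmentS h_mul /= eqxx.
by congr (mul _ (h _)); apply: eq_segment => k /andP[H _] /=; rewrite gtn_eqF.
Qed.

Let h_step_right (u : 'I_n.+1) k : u < k ->
  mul (h (segment w (pred1 (u : nat)) pred0 0 k)) (h [:: marked (onth w k) false false]) =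
  h (segment w (pred1 (u : nat)) pred0 0 k.+1).
Proof. by move=> uk; rewrite -[k.+1]addn1 segmentD h_mul /segment /= gtn_eqF. Qed.

Let h_step_left (u : 'I_n.+1) k : k < u ->
  mul (h [:: marked (onth w k) false false]) (h (segment w (pred1 (u : nat)) pred0 k.+1 (n - k))) =
  h (segment w (pred1 (u : nat)) pred0 k (n.+1 - k)).
Proof.
move=> ku; have kn : k <= n by apply: ltnW; apply: leq_trans ku _; rewrite -ltnS.
by rewrite (subSn kn) segmentS h_mul /= ltn_eqF.
Qed.

(** The head at tape position [c.2] is on node [c.2 - 1]. Going right, [t] is the value of the nodes
    strictly before it; going left, of the nodes strictly after it. In both cases the marked node
    [u] lies in that part. *)
Let invariant (c : Q * nat) (z : seq B) : Prop :=
  match c.1 with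
  | SI => z = [::]
  | SF => linked z
  | At k => exists (u : 'I_n.+1) (x : vertex),
      [/\ Start x.2 x.1, walk Gw x z (u, k) & c.2 = u.+1]
  | Going true e t => exists (u : 'I_n.+1) (x : vertex),
      [/\ Start x.2 x.1, walk Gw x z (u, e.1.1), u.+1 < c.2 &
          t = h (segment w (pred1 (u : nat)) pred0 0 c.2.-1)]
  | Going false e t => exists (u : 'I_n.+1) (x : vertex),
      [/\ Start x.2 x.1, walk Gw x z (u, e.1.1), c.2 <= u &
          t = h (segment w (pred1 (u : nat)) pred0 c.2 (n.+1 - c.2))]
  end.

(** Soundness: a letter is written only together with a test of the edge formula on the value of the
    whole marked word, reassembled from [t], the current letter and the annotation on the other
    side. *)
Let invariant_step c o c' z : invariant c z -> nstep SF Delta (annotate w) c o c' ->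
  invariant c' (z ++ seq_of_opt o).
Proof.
case: c => q i; case: c' => q' i' Hi [_ [mv]]; rewrite /= in Hi *.
case: q Hi => [[|]|[c|[[d e] t]]] /= Hi //.
- case: q' => [[|]|[c'|[[d' e'] t']]] //=; first by move=> [-> _] _; rewrite Hi.
  case E : tape => [||[[l x] r]] // [H -> ->] [<-].
  have [u [-> El Ex Er]] := tape_Sym E; rewrite El Ex Er in H.
  exists u, (u, c'); rewrite Hi; split=> //; apply/FS_P.
  by rewrite h_node.
- have [u [x0 [Sx0 Hw /= Eu]]] := Hi.
  case: q' => [[|]|[c'|[[[|] e'] t']]] //=; case E : tape => [||[[l x] r]] //;
    have [u' [Eu' El Ex Er]] := tape_Sym E;
    have uu : u' = u by [apply: ord_inj; apply: succn_inj; rewrite -Eu -Eu'];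
    rewrite {u'}uu in Eu' El Ex Er; rewrite ?El ?Ex ?Er.
  + move=> [H -> _] _; rewrite cats0; exists x0, (u, c); split=> //; apply/FL_P.
    by rewrite h_node.
  + move=> [b [H -> ->]] [<-]; exists u, x0; split=> //.
    rewrite cats1; apply/walk_rcons; exists (u, c) => //; apply/FG_P.
    rewrite h_node; first by rewrite /= eqxx.
    by move=> k /negbTE.
  + move=> [Ec -> -> ->] /=; case: ifP => // _ [<-]; rewrite cats0.
    by exists u, x0; rewrite Ec Eu /=; split.
  + move=> [Ec -> -> ->] /=; rewrite Eu' => -[<-]; rewrite cats0.
    by exists u, x0; rewrite Ec /=; split.
- case: d Hi => -[u [x0 [Sx0 /= Hw /= Hui /= Ht]]];
    case: q' => [[|]|[c'|[[[|] e'] t']]] //=; case E : tape => [||[[l x] r]] //;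
    have [v [Ev El Ex Er]] := tape_Sym E; rewrite ?El ?Ex ?Er Ht Ev /=.
  + move=> [-> H -> ->] [<-]; exists v, x0; split=> //.
    rewrite cats1; apply/walk_rcons; exists (u, e.1.1) => //; apply/FG_P.
    by rewrite h_right -?surjective_pairing //; rewrite Ev in Hui.
  + move=> [-> -> -> ->] /=; case: ifP => // _ [<-]; rewrite cats0.
    exists u, x0; split=> //; first by rewrite Ev in Hui; apply: ltnW.
    by rewrite h_step_right //; rewrite Ev in Hui.
  + move=> [-> H -> ->] [<-]; exists v, x0; split=> //.
    rewrite cats1; apply/walk_rcons; exists (u, e.1.1) => //; apply/FG_P.
    by rewrite h_left -?surjective_pairing //; rewrite Ev in Hui.
  + move=> [-> -> -> ->] /= [<-]; rewrite cats0.
    rewrite Ev in Hui; exists u, x0; split=> //; first exact: ltnW.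
    by rewrite subSS h_step_left.
Qed.

Local Notation step := (nstep (SF : Q) Delta (annotate w)).

Let pmap_cons (o : option B) y : pmap id (o :: y) = seq_of_opt o ++ pmap id y.
Proof. by case: o. Qed.

Let invariant_walk y c c' z : invariant c z -> walk step c y c' -> invariant c' (z ++ pmap id y).
Proof.
elim: y c z => [|o y IH] c z Hc; first by move=> <-; rewrite cats0.
by move=> [c1 Hs Hw]; rewrite pmap_cons catA; apply: IH Hw; exact: invariant_step Hs.
Qed.

Let goes (c : Q * nat) (z : seq B) (c' : Q * nat) := exists2 y, walk step c y c' & pmap id y = z.

Let goes_trans c z c1 z' c2 : goes c z c1 -> goes c1 z' c2 -> goes c (z ++ z') c2.
Proof.
move=> [y Hy <-] [y' Hy' <-]; exists (y ++ y'); last by rewrite pmap_cat.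
by apply/walk_cat; exists c1.
Qed.

Let goes_step c o c' : step c o c' -> goes c (seq_of_opt o) c'.
Proof. by move=> H; exists [:: o]; [exists c'|case: o H]. Qed.

Let goes_search i : i <= n.+1 -> goes (SI, 0) [::] (SI, i).
Proof.
elim: i => [|i IH] Hi; first by exists [::].
apply: (goes_trans (z' := [::]) (IH (ltnW Hi))); apply: (goes_step (o := None)).
by split=> //; exists MRight => //; rewrite /move size_annotate ltnS ifT // ltnW.
Qed.

Let goes_right e (u : 'I_n.+1) k v : u < k -> k <= v -> v <= n ->
  goes (Going true e (h (segment w (pred1 (u : nat)) pred0 0 k)), k.+1) [::]
       (Going true e (h (segment w (pred1 (u : nat)) pred0 0 v)), v.+1).
Proof.
move=> uk; elim: v => [|v IH] kv vn.
  by move: uk kv; rewrite leqn0 => + /eqP k0; rewrite k0.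
move: kv; rewrite leq_eqVlt => /orP[/eqP<-|kv]; first by exists [::].
apply: (goes_trans (z' := [::]) (IH kv (ltnW vn))); apply: (goes_step (o := None)).
split=> //; exists MRight; rewrite ?tape_annotate ?(ltnW vn) //.
  by split=> //; rewrite h_step_right // (leq_trans uk kv).
by rewrite /move size_annotate !ltnS ifT // ltnW.
Qed.

Let goes_left e (u : 'I_n.+1) k v : v <= k -> k <= u ->
  goes (Going false e (h (segment w (pred1 (u : nat)) pred0 k (n.+1 - k))), k) [::]
       (Going false e (h (segment w (pred1 (u : nat)) pred0 v (n.+1 - v))), v).
Proof.
elim: k => [|k IH]; first by rewrite leqn0 => /eqP->; exists [::].
rewrite leq_eqVlt => /orP[/eqP->|vk] ku; first by exists [::].
have kn : k <= n by apply: ltnW; apply: leq_trans ku _; rewrite -ltnS.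
apply: (goes_trans (z := [::])); last by apply: IH vk (ltnW ku).
apply: (goes_step (o := None)); split=> //; exists MLeft; rewrite ?tape_annotate //.
by split=> //; rewrite subSS h_step_left.
Qed.

(** Completeness, according to the target lying to the right of the source, to its left, or on the
    same node. *)
Let goes_edge (x y : vertex) b : Gw x b y ->
  goes (At x.2, (nat_of_ord x.1).+1) [:: b] (At y.2, (nat_of_ord y.1).+1).
Proof.
case: x y => [u c] [v c'] /FG_P /= HG.
have un : u <= n := ltn_ord u; have vn : v <= n := ltn_ord v.
case: (ltngtP (nat_of_ord u) v) => uv.
- apply: (goes_trans (z := [::]) (c1 := (Going true (c, c', b) (h (segment w (pred1 (u : nat)) pred0 0 u.+1)), u.+2))).
    apply: (goes_step (o := None)); split=> //; exists MRight.
      by rewrite (tape_annotate un); split=> //; rewrite h_leave_right.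
    by rewrite /move size_annotate !ltnS ifT.
  apply: (goes_trans (z := [::]) (goes_right _ (ltnSn u) uv vn)).
  apply: (goes_step (o := Some b)); split=> //; exists MStay; rewrite ?(tape_annotate un) ?(tape_annotate vn) //.
  by split=> //; move: HG; rewrite h_right.
- apply: (goes_trans (z := [::]) (c1 := (Going false (c, c', b) (h (segment w (pred1 (u : nat)) pred0 u (n.+1 - u))), nat_of_ord u))).
    apply: (goes_step (o := None)); split=> //; exists MLeft => //.
    by rewrite (tape_annotate un); split=> //; rewrite h_leave_left.
  apply: (goes_trans (z := [::]) (goes_left _ uv (leqnn u))).
  apply: (goes_step (o := Some b)); split=> //; exists MStay; rewrite ?(tape_annotate un) ?(tape_annotate vn) //.
  by split=> //; move: HG; rewrite h_left // subSS.
- apply: (goes_step (o := Some b)); split=> //; exists MStay; rewrite ?(tape_annotate un) ?(tape_annotate vn) //=; last by rewrite uv.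
  exists b; split=> //; move: HG; rewrite -uv h_node /= ?eqxx //.
  by move=> k /negbTE.
Qed.

Lemma walkerP z : realized (machine (SI : Q) SF Delta) (annotate w) z <-> linked z.
Proof.
rewrite machineP; split=> [[j [y [Hw ->]]]|[x [l [Sx Ll Hw]]]].
  exact: (@invariant_walk y (SI, 0) (SF, j) [::] erefl Hw).
suff [y Hy <-] : goes (SI, 0) z (SF, (nat_of_ord l.1).+1) by exists (nat_of_ord l.1).+1, y.
have xn : nat_of_ord x.1 <= n := ltn_ord x.1; have ln : nat_of_ord l.1 <= n := ltn_ord l.1.
apply: (goes_trans (z := [::]) (goes_search (xn : (nat_of_ord x.1).+1 <= n.+1))).
apply: (goes_trans (z := [::]) (c1 := (At x.2, (nat_of_ord x.1).+1))).
  apply: (goes_step (o := None)); split=> //; exists MStay; rewrite ?(tape_annotate xn) //.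
  by split=> //; move/FS_P: Sx; rewrite h_node.
rewrite -[z]cats0; apply: (goes_trans (c1 := (At l.2, (nat_of_ord l.1).+1))); last first.
  apply: (goes_step (o := None)); split=> //; exists MStay; rewrite ?(tape_annotate ln) //.
  by split=> //; move/FL_P: Ll; rewrite h_node.
elim: z x Hw {Sx xn} => [|b z IH] x; first by move=> ->; exists [::].
by move=> [x' Hx /IH]; apply: (goes_trans (z := [:: b])); exact: goes_edge.
Qed.

End OneWord.

Lemma linked_NGSM : NGSMk 2 linked.
Proof.
exists (gamma : finType), (fun w z => z = annotate w), (realized (machine (SI : Q) SF Delta)); split.
  exact: annotate_gsm.
split; first by exists (machine (SI : Q) SF Delta).
by move=> w z; rewrite -walkerP; split=> [H|[_ [->]]//]; exists (annotate w).
Qed.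
End Walker.

Lemma Def1_Rec (A : Type) P : @Def1 _ _ (@ed A) P -> exists2 L, Rec L &
  forall w (u : gV (ed w)), P w u <-> L (segment w (pred1 (nat_of_ord u)) pred0 0 (size w).+1).
Proof.
move=> [f [_ [_ Hf]]]; have [L RL HL] := mso_recognizable f; exists L => // w u.
by rewrite -encode1 -HL; split=> /(Hf w (tt, u)).
Qed.

Lemma Def2_Rec (A : Type) P : @Def2 _ _ (@ed A) P -> exists2 L, Rec L &
  forall w (u v : gV (ed w)), P w u v <->
    L (segment w (pred1 (nat_of_ord u)) (pred1 (nat_of_ord v)) 0 (size w).+1).
Proof.
move=> [f [_ [_ Hf]]]; have [L RL HL] := mso_recognizable f; exists L => // w u v.
by rewrite -encode2 -HL; split=> /(Hf w (tt, u, v)).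
Qed.

Section Linked.
Variables (A B C : finType).
Variables (Start Last : C -> forall w : seq A, gV (ed w) -> Prop).
Variable G : C -> C -> B -> forall w : seq A, gV (ed w) -> gV (ed w) -> Prop.
Hypothesis Start_def : forall c, Def1 (Start c).
Hypothesis Last_def : forall c, Def1 (Last c).
Hypothesis G_def : forall c c' b, Def2 (G c c' b).

(** All start, end and edge formulas are evaluated in one multiplication, indexed by a disjoint sum,
    so that one annotation suffices. *)
Lemma linked_NGSMk : NGSMk 2 (linked Start Last G).
Proof.
pose lang (j : C + C + C * C * B) (L : seq (letter A) -> Prop) :=
  match j with
  | inl (inl c) => forall w (u : gV (ed w)),
      Start c u <-> L (segment w (pred1 (nat_of_ord u)) pred0 0 (size w).+1)
  | inl (inr c) => forall w (u : gV (ed w)),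
      Last c u <-> L (segment w (pred1 (nat_of_ord u)) pred0 0 (size w).+1)
  | inr (c, c', b) => forall w (u v : gV (ed w)), G c c' b u v <->
      L (segment w (pred1 (nat_of_ord u)) (pred1 (nat_of_ord v)) 0 (size w).+1)
  end.
have [j|L HL] := @choice _ _ (fun j L => Rec L /\ lang j L).
  case: j => [[c|c]|[[c c'] b]].
  - by have [L RL HL] := Def1_Rec (Start_def c); exists L.
  - by have [L RL HL] := Def1_Rec (Last_def c); exists L.
  - by have [L RL HL] := Def2_Rec (G_def c c' b); exists L.
have [M [mul [h [Hh [F HF]]]]] := Rec_family (fun j => (HL j).1).
apply: (@linked_NGSM _ _ _ Start Last G M mul h Hh (fun c => F (inl (inl c)))
  (fun c => F (inl (inr c))) (fun e => F (inr e))).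
- by move=> c w u; rewrite -HF; exact: (HL (inl (inl c))).2.
- by move=> c w u; rewrite -HF; exact: (HL (inl (inr c))).2.
- by move=> c c' b w u v; rewrite -HF; exact: (HL (inr (c, c', b))).2.
Qed.
End Linked.

(** * Output graphs as walks between definable nodes *)

Lemma walk_homo (X Y L : Type) (E : X -> L -> X -> Prop) (E' : Y -> L -> Y -> Prop) (f : X -> Y) :
  (forall x b y, E x b y -> E' (f x) b (f y)) ->
  forall x z y, walk E x z y -> walk E' (f x) z (f y).
Proof.
move=> H x z y; elim: z x => [x ->//|b z IH x /= [x' /H Hx /IH Hw]]; by exists (f x').
Qed.

Lemma ed_det (B : Type) (z : seq B) x b y b' y' :
  gE (ed z) x b y -> gE (ed z) x b' y' -> b = b' /\ y = y'.
Proof.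
move=> [H1 H2] [H1' H2']; split; first by move: H2; rewrite H2' => -[].
by apply: ord_inj; rewrite H1 H1'.
Qed.

Lemma ed_last_stuck (B : Type) (z : seq B) b (y : gV (ed z)) : ~ gE (ed z) ord_max b y.
Proof. by move=> [_]; rewrite onth_default. Qed.

Lemma ed_walk (B : Type) (z : seq B) : walk (@gE _ _ (ed z)) ord0 z ord_max.
Proof.
have H i : forall Hi : i < (size z).+1, walk (@gE _ _ (ed z)) (Ordinal Hi) (drop i z) ord_max.
  move En : (size z - i) => n; elim: n i En => [|n IH] i En Hi.
    have Ei : i = size z by apply/eqP; rewrite eqn_leq -ltnS Hi -subn_eq0 En.
    by rewrite drop_oversize ?Ei //=; apply: ord_inj.
  have Hi' : i < size z by rewrite -subn_gt0 En.
  have [b Hb] : exists b, onth z i = Some b by move: Hi'; rewrite -onthTE; case: (onth z i) => // b; exists b.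
  have Hn : nth b z i = b by exact: onth_nth Hb.
  rewrite (drop_nth b Hi') Hn; exists (Ordinal (Hi' : i.+1 < (size z).+1)) => //.
  by apply: IH; rewrite subnS En.
have := H 0 isT; rewrite drop0; congr (walk _ _ _ _); exact: ord_inj.
Qed.

Lemma string_mso_NGSMk (A B : finType) (m : transduction A B) : string_mso m -> NGSMk 2 m.
Proof.
move=> [mf [C [N [E [HD HN HE Hm]]]]].
pose G (c c' : C) b w (u v : gV (ed w)) := [/\ N c w u, N c' w v & E c c' b w u v].
(* Outside the domain of [m] the formulas may describe any graph, so the domain is tested at the
   start. First and last output nodes are recognized by the absence of incoming and outgoing
   edges. *)
pose Start c w (u : gV (ed w)) := [/\ exists z, m w z, N c w u &
  ~ exists c', exists b, exists v : gV (ed w), G c' c b w v u].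
pose Last c w (u : gV (ed w)) := N c w u /\ ~ exists c', exists b, exists v : gV (ed w), G c c' b w u v.
have DG (c : ctx (@ed A)) k k' b t t' : Acc t -> Acc t' ->
    @Def _ _ _ c (fun w e => G k k' b w (t w e) (t' w e)).
  move=> Ht Ht'; apply: (@Def_ext _ _ _ _ (fun w e =>
    N k w (t w e) /\ N k' w (t' w e) /\ E k k' b w (t w e) (t' w e))).
    by move=> w e; split=> [[? []]|[]].
  apply: Def_and; first exact: Def1_use (HN k) Ht.
  by apply: Def_and; [exact: Def1_use (HN k') Ht'|exact: Def2_use (HE k k' b) Ht Ht'].
suff Hlinked w z : m w z <-> linked Start Last G w z.
  have [c|c|c c' b|D [m1 [m2 [H1 [H2 H]]]]] := @linked_NGSMk _ _ _ Start Last G; last first.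
  - by exists D, m1, m2; split=> //; split=> // w z; rewrite Hlinked; exact: H.
  - by rewrite /Def2; apply: DG; acc.
  - rewrite /Def1; apply: Def_and; first by apply: Def1_use (HN c) _; acc.
    by apply: Def_not; do 3!def1; apply: DG; acc.
  - apply: (@Def_ext _ _ _ _ (fun w (e : env (extN (c0 (@ed A))) w) => (exists z, m w z) /\ N c w e.2 /\
      ~ exists c', exists b, exists v : gV (ed w), G c' c b w v e.2)).
      by move=> w e; split=> [[? []]|[]].
    apply: Def_and; first exact: Def0_use HD.
    apply: Def_and; first by apply: Def1_use (HN c) _; acc.
    by apply: Def_not; do 3!def1; apply: DG; acc.
have Hiso z0 (Hz : m w z0) : exists f : gV (ed z0) -> gV (ed w) * C,
    [/\ forall p, N p.2 w p.1 <-> exists v, f v = p &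
        forall v b v', gE (ed z0) v b v' <-> Gw G (f v) b (f v')].
  have [f [_ fn fe]] := Hm _ _ Hz; exists f; split=> // v b v'.
  rewrite fe /Gw /G; split=> [H|[]//]; split=> //; apply/fn; by [exists v|exists v'].
split=> [Hz|[x [l [[[z0 Hz0] Nx Hx] [Nl Hl] Hw]]]].
- have [f [fn fe]] := Hiso z Hz.
  exists (f ord0), (f ord_max); split.
  + split; [by exists z|by apply/fn; exists ord0|].
    move=> [c [b [v HG]]]; have [v' Hv'] := (fn (v, c)).1 (let: And3 H _ _ := HG in H).
    have /fe[] : Gw G (f v') b (f ord0) by rewrite Hv'.
    by [].
  + split; first by apply/fn; exists ord_max.
    move=> [c [b [v HG]]]; have [v' Hv'] := (fn (v, c)).1 (let: And3 _ H _ := HG in H).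
    have /fe : Gw G (f ord_max) b (f v') by rewrite Hv'.
    exact: ed_last_stuck.
  + by apply: (walk_homo (f := f)) (ed_walk z) => v b v' /fe.
- have [f [fn fe]] := Hiso z0 Hz0.
  have [x0 Ex] := (fn x).1 Nx; have [l0 El] := (fn l).1 Nl.
  (* An incoming edge of [x0] would be mapped by [f] to an edge into the start node. *)
  have {}Hx : x0 = ord0.
    apply/ed_first => -[b [t /fe Ht]]; apply: Hx; exists (f t).2, b, (f t).1.
    by rewrite -Ex.
  have {}Hl : forall b y, ~ gE (ed z0) l0 b y.
    by move=> b y /fe Hy; apply: Hl; exists (f y).2, b, (f y).1; rewrite -El.
  (* The walk lifts along [f] to [ed z0], where it joins the first node to a node without outgoing
     edge; such a walk is unique and reads [z0]. *)
  have Hpull v l1 : walk (Gw G (w := w)) (f v) z l1 -> exists2 v', f v' = l1 & walk (@gE _ _ (ed z0)) v z v'.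
    elim: (z) v => [|b z' IH] v /=; first by move=> <-; exists v.
    move=> [[u c] HG Hw']; have [v1 Hv1] := (fn (u, c)).1 (let: And3 _ H _ := HG in H).
    rewrite -Hv1 in HG Hw'; have [v' Hv' Hw1] := IH _ Hw'.
    by exists v' => //; exists v1 => //; apply/fe.
  rewrite -Ex Hx in Hw; have [v' Hv' Hw'] := Hpull _ _ Hw.
  suff -> : z = z0 by [].
  apply: (@walk_stuck_unique _ _ _ (@ed_det _ z0)) (@ed_last_stuck _ z0) Hw' (ed_walk z0) => b y /fe.
  by rewrite Hv' -El => /fe /Hl.
Qed.

Theorem theorem6p11 (A B : finType) (m : seq A -> seq B -> Prop) :
  MSOed m <-> ((exists k, 1 <= k /\ NGSMk k m) /\ functional m).
Proof.
split=> [/MSOed_string Hm|[[k [_ Hk]] Hf]].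
  by split; [exists 2; split=> //; exact: string_mso_NGSMk|case: Hm].
exact: string_MSOed (functional_NGSMk_string_mso Hk Hf).
Qed.
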